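(* Let $M^n$ be a connected, compact, closed, smooth manifold of dimension $n$, equipped with a fixed smooth triangulation. Then there exist subsets $C^n, K^{n-1}\subset M^n$ such that $$M^n = C^n \cup K^{n-1},\qquad C^n\cap K^{n-1}=\varnothing,$$ where $C^n$ is an $n$-dimensional cell and $K^{n-1}$ is a union of some finite number of $(n-1)$-simplexes of the triangulation.
   Context: ''Closed'' means without boundary. An $n$-dimensional cell on $M^n$ is an open subset of $M^n$ (a coordinate neighborhood) homeomorphic to the open standard simplex $\mathrm{Int}\,\Delta^n$, equivalently to an open ball of $\mathbf{R}^n$. The standard simplex is $\Delta^l=\{x\in\mathbf{R}^l : 0\le x_i\le 1,\ x_1+\dots+x_l\le 1\}$. Smooth triangulation: for each $l$, $0\le l\le n$, there is a finite set $\Phi^l$ of maps $\varphi:\Delta^l\to M^n$, each being the restriction of a diffeomorphism of an open neighborhood of $\Delta^l$ in $\mathbf{R}^l$ onto its image in $M^n$, such that (a) $M^n$ is the disjoint union of the images $\varphi(\mathrm{Int}\,\Delta^l)$, over all $l$ and all $\varphi\in\Phi^l$; (b) if $\varphi\in\Phi^l$, $l\ge 1$, then $\varphi\circ\varepsilon_i\in\Phi^{l-1}$ for every $i$, where $\varepsilon_i:\Delta^{l-1}\to\Delta^l$ is the linear map sending the vertexes $v_0,\dots,v_{l-1}$ of $\Delta^{l-1}$ to the vertexes $v_0,\dots,\hat v_i,\dots,v_l$ of $\Delta^l$ ($v_i$ omitted). The (closed) $l$-simplexes of the triangulation are the sets $\varphi(\Delta^l)$, $\varphi\in\Phi^l$.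 *)

(* Defs.v *)
(* The real line is an arbitrary R : realType, and R^l is 'rV[R]_l. *)
From HB Require Import structures.
From mathcomp Require Export all_boot all_order all_algebra.
From mathcomp Require Export all_classical all_reals all_analysis.
Export numFieldNormedType.Exports.

Set Implicit Arguments.
Unset Strict Implicit.
Unset Printing Implicit Defensive.

Import Order.TTheory GRing.Theory Num.Theory.

Local Open Scope classical_set_scope.
Local Open Scope ring_scope.

(* A and B carry their subspace topologies, as the subtypes they coerce to. *)
Definition homeomorphic (X Y : topologicalType) (A : set X) (B : set Y) :
    Prop :=
  exists (f : A -> B) (g : B -> A),
    [/\ cancel f g, cancel g f, continuous f & continuous g].

(* Meant for open U: f is C^k on U when its iterated partial derivatives of
   order at most k exist and are continuous at the points of U. *)
Fixpoint Ck_on (R : realType) (n m k : nat) (U : set 'rV[R]_n)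
    (f : 'rV[R]_n -> 'rV[R]_m) : Prop :=
  {in U, continuous f} /\
  if k is k'.+1 then
    forall i : 'I_n, {in U, forall x, derivable f x (delta_mx 0 i)} /\
      Ck_on k' U (fun x => 'D_(delta_mx 0 i) f x)
  else True.

Definition smooth_on (R : realType) (n m : nat) (U : set 'rV[R]_n)
    (f : 'rV[R]_n -> 'rV[R]_m) : Prop :=
  forall k, Ck_on k U f.

(* chart_map and chart_inv are total functions; only their values on chart_dom
   and on its image are meaningful. *)
Record chart (R : realType) (n : nat) (M : topologicalType) := Chart {
  chart_dom : set M;
  chart_map :> M -> 'rV[R]_n;
  chart_inv : 'rV[R]_n -> M;
  chart_dom_open : open chart_dom;
  chart_img_open : open (chart_map @` chart_dom);
  chart_mapK : {in chart_dom, cancel chart_map chart_inv};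
  chart_map_continuous : {within chart_dom, continuous chart_map};
  chart_inv_continuous :
    {within chart_map @` chart_dom, continuous chart_inv} }.

(* Charts take values in open subsets of R^n, hence there is no boundary. *)
Record smooth_manifold (R : realType) (n : nat) (M : topologicalType) :=
  SmoothManifold {
  manifold_hausdorff : hausdorff_space M;
  manifold_second_countable : @second_countable M;
  atlas : set (chart R n M);
  atlas_cover : \bigcup_(c in atlas) chart_dom c = setT;
  atlas_compatible : forall c1 c2, atlas c1 -> atlas c2 ->
    smooth_on (c1 @` (chart_dom c1 `&` chart_dom c2)) (c2 \o chart_inv c1) }.

Section SmoothMaps.
Variables (R : realType) (n : nat) (M : topologicalType).
Variable X : smooth_manifold R n M.

(* W is meant to be open in R^l. *)
Definition smooth_into (l : nat) (W : set 'rV[R]_l) (f : 'rV[R]_l -> M) :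
    Prop :=
  {in W, continuous f} /\
  forall c, atlas X c -> smooth_on (W `&` f @^-1` chart_dom c) (c \o f).

(* N is meant to be open in M. *)
Definition smooth_from (l : nat) (N : set M) (g : M -> 'rV[R]_l) : Prop :=
  forall c, atlas X c ->
    smooth_on (c @` (N `&` chart_dom c)) (g \o chart_inv c).

(* Smoothness of a map on an arbitrary subset A of M: it extends, around each
   point of A, to a smooth map on an open subset of M. *)
Definition smooth_from_subset (l : nat) (A : set M) (g : M -> 'rV[R]_l) :
    Prop :=
  forall p, A p -> exists (N : set M) (G : M -> 'rV[R]_l),
    [/\ open N, N p, smooth_from N G & {in A `&` N, G =1 g}].

Definition diffeo_onto_image (l : nat) (W : set 'rV[R]_l)
    (f : 'rV[R]_l -> M) : Prop :=
  smooth_into W f /\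
  exists g : M -> 'rV[R]_l,
    {in W, cancel f g} /\ smooth_from_subset (f @` W) g.

End SmoothMaps.

Definition simplex (R : realType) (l : nat) : set 'rV[R]_l :=
  [set x | (forall i, 0 <= x 0 i <= 1) /\ \sum_(i < l) x 0 i <= 1].

Arguments simplex : clear implicits.

Section StandardSimplex.
Variable R : realType.

(* v_0 is the origin and v_1, ..., v_l are the standard basis vectors. *)
Definition vertex (l : nat) (i : 'I_l.+1) : 'rV[R]_l :=
  if unlift ord0 i is Some j then delta_mx 0 j else 0.

Definition barycentric (l : nat) (x : 'rV[R]_l) (i : 'I_l.+1) : R :=
  if unlift ord0 i is Some j then x 0 j else 1 - \sum_(j < l) x 0 j.

(* The affine map sending v_j to v_(lift i j), i.e. onto the face opposite to
   v_i. *)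
Definition face_map (l : nat) (i : 'I_l.+2) (x : 'rV[R]_l) : 'rV[R]_l.+1 :=
  \sum_(j < l.+1) barycentric x j *: vertex (lift i j).

Lemma barycentric_vertex l (i j : 'I_l.+1) :
  barycentric (vertex i) j = (j == i)%:R.
Proof.
rewrite /barycentric /vertex.
case: (unliftP ord0 j) => [j'|] ->; case: (unliftP ord0 i) => [i'|] ->.
- by rewrite mxE eqxx /= (inj_eq lift_inj).
- by rewrite mxE eq_sym (negbTE (neq_lift _ _)).
- rewrite (negbTE (neq_lift _ _)) (bigD1 i') //= big1 => [|k ki].
    by rewrite mxE !eqxx addr0 subrr.
  by rewrite mxE (negbTE ki) andbF.
- by rewrite eqxx big1 ?subr0// => k _; rewrite mxE.
Qed.

Lemma face_map_vertex l (i : 'I_l.+2) (j : 'I_l.+1) :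
  face_map i (vertex j) = vertex (lift i j).
Proof.
rewrite /face_map (bigD1 j) //= big1 => [|k kj].
  by rewrite barycentric_vertex eqxx scale1r addr0.
by rewrite barycentric_vertex (negbTE kj) scale0r.
Qed.

Lemma face_map_simplex l (i : 'I_l.+2) (x : 'rV[R]_l) :
  simplex R l x -> simplex R l.+1 (face_map i x).
Proof.
move=> [x01 x1].
have b0 j : 0 <= barycentric x j.
  rewrite /barycentric; case: (unlift _ _) => [k|]; last by rewrite subr_ge0.
  by have /andP[] := x01 k.
have b1 : \sum_j barycentric x j = 1.
  rewrite big_ord_recl (eq_bigr (fun j => x 0 j)) => [|j _].
    by rewrite /barycentric unlift_none subrK.
  by rewrite /barycentric liftK.
have v0 m (p : 'I_m.+1) k : 0 <= vertex p 0 k.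
  by rewrite /vertex; case: (unlift _ _) => [q|]; rewrite mxE ?ler0n.
have v1 m (p : 'I_m.+1) : \sum_k vertex p 0 k <= 1.
  rewrite /vertex; case: (unlift _ _) => [q|]; last first.
    by rewrite big1// => k _; rewrite mxE.
  rewrite (bigD1 q)//= big1 => [|k kq]; first by rewrite mxE !eqxx addr0.
  by rewrite mxE (negbTE kq) andbF.
have fE k : face_map i x 0 k =
    \sum_j barycentric x j * vertex (lift i j) 0 k.
  by rewrite /face_map summxE; apply: eq_bigr => j _; rewrite mxE.
have f0 k : 0 <= face_map i x 0 k.
  by rewrite fE sumr_ge0// => j _; rewrite mulr_ge0.
have f1 : \sum_k face_map i x 0 k <= 1.
  under eq_bigr do rewrite fE.
  rewrite exchange_big/= -b1 ler_sum// => j _.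
  by rewrite -mulr_sumr; apply: ler_piMr; [exact: b0 | exact: v1].
split=> // k; rewrite f0/=; apply: le_trans f1.
by rewrite (bigD1 k)//= lerDl sumr_ge0.
Qed.

Definition face (l : nat) (i : 'I_l.+2) (x : simplex R l) : simplex R l.+1 :=
  exist _ (face_map i (val x))
    (mem_set (face_map_simplex i (set_mem (valP x)))).

End StandardSimplex.

Section Triangulation.
Variables (R : realType) (n : nat) (M : topologicalType).
Variable X : smooth_manifold R n M.

Definition smooth_simplex (l : nat) (phi : simplex R l -> M) : Prop :=
  exists (W : set 'rV[R]_l) (psi : 'rV[R]_l -> M),
    [/\ open W, simplex R l `<=` W, diffeo_onto_image X W psi &
        forall x : simplex R l, phi x = psi (val x)].

Definition open_simplex (l : nat) (phi : simplex R l -> M) : set M :=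
  phi @` [set x | (simplex R l)° (val x)].

Record smooth_triangulation := SmoothTriangulation {
  tri : forall l : nat, set (simplex R l -> M);
  tri_dim : forall l, (n < l)%N -> @tri l = set0;
  tri_finite : forall l, finite_set (@tri l);
  tri_smooth : forall l (phi : simplex R l -> M), tri phi -> smooth_simplex phi;
  tri_cover : \bigcup_l \bigcup_(phi in @tri l) open_simplex phi = setT;
  tri_disjoint :
    trivIset [set s : {l : nat & simplex R l -> M} | tri (tagged s)]
             (fun s => open_simplex (tagged s));
  tri_face : forall l (phi : simplex R l.+1 -> M) (i : 'I_l.+2),
    tri phi -> tri (phi \o @face R l i) }.

Definition closed_simplexes (T : smooth_triangulation) (l : nat) :
    set (set M) :=
  [set range phi | phi in @tri T l].

End Triangulation.

Definition is_cell (R : realType) (n : nat) (M : topologicalType) (C : set M) :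
    Prop :=
  open C /\ homeomorphic C (simplex R n)°.

(* Main.v *)
From Stdlib Require Import Eqdep_dec.
Require Import Defs.
From mathcomp Require Import finmap ring lra.
Set Implicit Arguments.
Unset Strict Implicit.
Unset Printing Implicit Defensive.
Import Order.TTheory GRing.Theory Num.Theory Num.Def.

Local Open Scope classical_set_scope.
Local Open Scope ring_scope.

(** The cell is grown one n-simplex at a time. It starts as an open n-simplex.
    As long as some n-simplex is missing, a missing one shares a facet sigma
    with one already used; the open simplex sigma and the missing open
    n-simplex are then added. At the end C consists of all open n-simplexes and
    of the open (n-1)-simplexes that were crossed, which are the edges of a
    spanning tree of the dual graph, and K is the union of the closed
    (n-1)-simplexes that were not crossed.

    There is always a next simplex ([strongly_connected]) because simplexes of
    codimension at least 2 do not disconnect M locally: seen from a point, they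
    hide a set of dimension less than n, so segments can be moved off them. The
    dimension count is done by counting boxes of radius 1/N, for which all that
    is needed is that C^1 maps are locally Lipschitz; it also shows that the
    n-simplexes cover M.

    Gluing a simplex across a facet does not change the cell up to
    homeomorphism ([glue_simplex]): the new simplex is pushed through the facet
    into the old one by a radial map, which is the identity near the other
    facets of the old simplex and so extends by the identity.

    An (n-1)-simplex has at most two cofaces ([at_most_two_cofaces]): by the
    inverse function theorem, a smooth n-simplex extends across a facet to a
    homeomorphism onto a neighborhood, and what lies beyond the facet is
    connected. Hence a wall opened between two used simplexes is not a wall of
    any other one.

    Finally K must contain every simplex of codimension at least 2, that is,
    some (n-1)-simplex through each of its points stays closed. When the last
    n-simplex containing the point was added, two of its facets contained the
    point and only one of them was opened ([growth_wall]). *)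

(** * Row vectors *)

Section RowVectors.
Variable R : realType.

Lemma norm_coord n (x : 'rV[R]_n) i : `|x 0 i| <= `|x|.
Proof.
rewrite [leRHS]/normr /= mx_normrE; apply/bigmax_geP; right => /=.
by exists (0, i).
Qed.

Lemma norm_rV_le n (x : 'rV[R]_n) (e : R) :
  0 <= e -> (forall i, `|x 0 i| <= e) -> `|x| <= e.
Proof.
move=> e0 xe; rewrite [leLHS]/normr /= mx_normrE.
by apply/bigmax_leP; split=> // -[i j] _ /=; rewrite ord1.
Qed.

Lemma norm_mulmx_le m n (A : 'M[R]_(m, n)) :
  exists2 K : R, 0 < K & forall x : 'rV[R]_m, `|x *m A| <= K * `|x|.
Proof.
exists (1 + \sum_i `|row i A|).
  by rewrite ltr_pwDl // sumr_ge0.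
move=> x; rewrite mulmx_sum_row.
apply: (le_trans (ler_norm_sum _ _ _)).
rewrite mulrDl mul1r mulr_suml; apply: (@le_trans _ _ (\sum_i `|row i A| * `|x|)).
  by apply: ler_sum => i _; rewrite normrZ mulrC ler_wpM2l // norm_coord.
by rewrite lerDr.
Qed.

Lemma cvg_coord n (T : Type) (F : set_system T) (FF : Filter F)
    (f : T -> 'rV[R]_n) (a : 'rV[R]_n) i :
  f @ F --> a -> (f x 0 i) @[x --> F] --> a 0 i.
Proof.
move=> fa; apply: (@cvg_comp _ _ _ f (fun v : 'rV_n => v 0 i) _ _ _ fa).
exact: coord_continuous.
Qed.

Lemma continuous_at_norm (V W : normedModType R) (f : V -> W) (a : V) :
  (forall e : R, 0 < e -> exists2 d : R, 0 < d &
     forall u, `|u - a| < d -> `|f u - f a| < e) -> {for a, continuous f}.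
Proof.
move=> H; apply/cvgrPdist_lt => e /H[d d0 Hd].
apply/nbhs_ballP; exists d => // u; rewrite -ball_normE /ball_ /= distrC => /Hd.
by rewrite distrC.
Qed.

Lemma continuous_mulmxr m n (A : 'M[R]_(m, n)) :
  continuous (fun x : 'rV[R]_m => x *m A).
Proof.
move=> a; have [K K0 AK] := norm_mulmx_le A.
apply: continuous_at_norm => e e0; exists (e / K); first by rewrite divr_gt0.
move=> u ua; rewrite -mulmxBl (le_lt_trans (AK _)) // mulrC.
by rewrite -ltr_pdivlMr.
Qed.

End RowVectors.

Lemma convex_ball (R : numFieldType) (V : normedModType R) (p q : V) (u d : R) :
  `|p| < d -> `|q| < d -> 0 <= u -> u <= 1 -> `|(1 - u) *: p + u *: q| < d.
Proof.
move=> pd qd u0 u1; apply: (le_lt_trans (ler_normD _ _)); rewrite !normrZ.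
rewrite (ger0_norm u0) ger0_norm ?subr_ge0 //.
have [->|uN0] := eqVneq u 0; first by rewrite subr0 mul0r addr0 mul1r.
have up : 0 < u by rewrite lt_neqAle eq_sym uN0.
have -> : d = (1 - u) * d + u * d by rewrite -mulrDl subrK mul1r.
by rewrite ler_ltD // ?ltr_pM2l // ler_wpM2l ?subr_ge0 // ltW.
Qed.

Lemma exists_pos_lt2 (R : realFieldType) (a b : R) :
  0 < a -> 0 < b -> exists2 q, 0 < q & (q < a) && (q < b).
Proof.
move=> a0 b0; have mp : 0 < Num.min a b by rewrite lt_min a0.
exists (Num.min a b / 2); first by rewrite divr_gt0.
by rewrite -lt_min ltr_pdivrMr // ltr_pMr // ltr1n.
Qed.

(** * Strict differentiability of C^1 maps *)

Section Calculus.
Variable R : realType.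

Lemma partial_is_derive m n (f : 'rV[R]_m -> 'rV[R]_n) (w : 'rV[R]_m)
    (i : 'I_m) (c : 'I_n) (t : R) :
  derivable f (w + t *: delta_mx 0 i) (delta_mx 0 i) ->
  is_derive t 1 (fun s => f (w + s *: delta_mx 0 i) 0 c)
    (('D_(delta_mx 0 i) f (w + t *: delta_mx 0 i)) 0 c).
Proof.
set v := delta_mx 0 i => df.
set a := 'D_v f _.
pose g := fun s => f (w + s *: v) 0 c.
have cv : h^-1 *: (g (h *: 1 + t) - g t) @[h --> 0^'] --> a 0 c.
  have -> : (fun h => h^-1 *: (g (h *: 1 + t) - g t)) =
      (fun h => (h^-1 *: (f (h *: v + (w + t *: v)) - f (w + t *: v))) 0 c).
    apply/funext => h; rewrite /g !mxE.
    have -> // : w + (h *: (1 : R) + t) *: v = h *: v + (w + t *: v).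
    by rewrite scalerDl -[h *: (1 : R)]/(h * 1) mulr1 addrCA.
  by apply: cvg_coord; exact: df.
by split; [exact: cvgP cv | exact: cvg_lim cv].
Qed.

(** Mean value inequality along one coordinate axis, for f minus the linear
    map that has partial derivative a. *)
Lemma partial_increment m n (f : 'rV[R]_m -> 'rV[R]_n) (x : 'rV[R]_m)
    (i : 'I_m) (a : 'rV[R]_n) (d e : R) :
  (forall y, `|y - x| < d -> derivable f y (delta_mx 0 i)) ->
  (forall y, `|y - x| < d -> `|'D_(delta_mx 0 i) f y - a| <= e) ->
  forall w s, `|w - x| < d -> `|w + s *: delta_mx 0 i - x| < d ->
    `|f (w + s *: delta_mx 0 i) - f w - s *: a| <= e * `|s|.
Proof.
set v := delta_mx 0 i => df De.
suff pos w s : 0 <= s -> `|w - x| < d -> `|w + s *: v - x| < d ->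
    `|f (w + s *: v) - f w - s *: a| <= e * `|s|.
  move=> w s wx wsx; have [s0|s0] := leP 0 s; first exact: pos.
  have := pos (w + s *: v) (- s); rewrite scaleNr addrK normrN oppr_ge0 ltW//.
  move=> /(_ erefl wsx wx); rewrite -normrN; congr (`|_| <= _).
  by rewrite scaleNr opprK opprD opprB.
move=> s0 wx wsx.
have e0 : 0 <= e by apply: le_trans (De _ wx).
have convex t : t \in `[0, s] -> `|w + t *: v - x| < d.
  rewrite in_itv /= => /andP[t0 ts].
  have [s00|sN0] := eqVneq s 0.
    have -> : t = 0 by apply/eqP; rewrite eq_le t0 -s00 ts.
    by rewrite scale0r addr0.
  have sp : 0 < s by rewrite lt_neqAle eq_sym sN0.
  have -> : w + t *: v - x = (1 - t / s) *: (w - x) + (t / s) *: (w + s *: v - x).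
    rewrite [w + s *: v - x]addrAC (scalerDr (t / s)) addrA -scalerDl subrK.
    by rewrite scale1r scalerA divfK // addrAC.
  have ts1 : t / s <= 1 by rewrite ler_pdivrMr // mul1r.
  have ts0 : 0 <= t / s by rewrite divr_ge0.
  exact: convex_ball.
apply: norm_rV_le => [|c]; first by rewrite mulr_ge0.
pose g := fun t => f (w + t *: v) 0 c.
pose dg := fun t => ('D_v f (w + t *: v)) 0 c.
have gd t : t \in `[0, s] -> is_derive t 1 g (dg t).
  by move=> /convex ct; apply: partial_is_derive; exact: df.
have gd' t : t \in `]0, s[ -> is_derive t 1 g (dg t).
  by move=> ts; apply: gd; exact: subset_itv_oo_cc.
have gc : {within `[0, s], continuous g}.
  by apply: derivable_within_continuous => t /gd [].
have [t ts E] := MVT_segment s0 gd' gc.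
have -> : (f (w + s *: v) - f w - s *: a) 0 c = (dg t - a 0 c) * s.
  have -> : (f (w + s *: v) - f w - s *: a) 0 c = g s - g 0 - s * a 0 c.
    by rewrite /g scale0r addr0 !mxE.
  by rewrite E subr0 mulrBl [s * _]mulrC.
rewrite normrM ler_wpM2r //.
have -> : dg t - a 0 c = ('D_v f (w + t *: v) - a) 0 c by rewrite !mxE.
by apply: le_trans (norm_coord _ _) _; apply: De; exact: convex.
Qed.

Definition strictly_differentiable m n (f : 'rV[R]_m -> 'rV[R]_n)
    (x : 'rV[R]_m) (J : 'M[R]_(m, n)) :=
  forall e, 0 < e -> exists2 d, 0 < d &
    forall y z, `|y - x| < d -> `|z - x| < d ->
      `|f y - f z - (y - z) *m J| <= e * `|y - z|.

(** One passes from z to y by changing the coordinates one at a time. The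
    hybrid points stay in the ball because it is a ball for the sup norm, so
    each of the m steps obeys the mean value inequality of [partial_increment]. *)
Lemma C1_strictly_differentiable m n (U : set 'rV[R]_m)
    (f : 'rV[R]_m -> 'rV[R]_n) (x : 'rV[R]_m) :
  open U -> U x -> Ck_on 1 U f ->
  exists J, strictly_differentiable f x J.
Proof.
move=> oU Ux [_ D].
pose J := \matrix_(i < m) 'D_(delta_mx 0 i) f x.
exists J => e e0.
pose e' := e / m.+1%:R.
have e'0 : 0 < e' by rewrite divr_gt0.
have : \forall y \near x, U y /\ forall i : 'I_m,
    `|'D_(delta_mx 0 i) f x - 'D_(delta_mx 0 i) f y| < e'.
  near=> y; split; first by near: y; exact: open_nbhs_nbhs.
  near: y; apply: filter_forall => i.
  have [_ [cD _]] := D i.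
  have /cvgrPdist_lt/(_ _ e'0) := cD _ (mem_set Ux).
  exact.
move=> /nbhs_ballP[d /= d0 Hd].
have Hd' y : `|y - x| < d -> U y /\ forall i : 'I_m,
    `|'D_(delta_mx 0 i) f y - 'D_(delta_mx 0 i) f x| <= e'.
  move=> yx; have [Uy H] : U y /\ forall i : 'I_m,
    `|'D_(delta_mx 0 i) f x - 'D_(delta_mx 0 i) f y| < e'.
    by apply: Hd; rewrite -ball_normE /ball_ /= distrC.
  by split; [exact: Uy | move=> i; rewrite distrC ltW].
exists d => // y z yx zx.
pose w k := \row_(j < m) if (j < k)%N then y 0 j else z 0 j.
have w0 : w 0%N = z by apply/rowP => j; rewrite mxE.
have wm : w m = y by apply/rowP => j; rewrite mxE ltn_ord.
have wx k : `|w k - x| < d.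
  have [M Mlt [yM zM]] : exists2 M, M < d & `|y - x| <= M /\ `|z - x| <= M.
    exists (Num.max `|y - x| `|z - x|); first by rewrite gt_max yx.
    by split; rewrite le_max lexx ?orbT.
  apply: le_lt_trans Mlt; apply: norm_rV_le => [|j]; first exact: le_trans yM.
  rewrite !mxE; case: ifP => _.
    by apply: le_trans yM; have := norm_coord (y - x) j; rewrite !mxE.
  by apply: le_trans zM; have := norm_coord (z - x) j; rewrite !mxE.
have wS (k : 'I_m) : w k.+1 = w k + (y - z) 0 k *: delta_mx 0 k.
  apply/rowP => j; rewrite !mxE ltnS leq_eqVlt eqxx /=.
  have [->|jk] := eqVneq j k; first by rewrite ltnn eqxx /= mulr1 addrC subrK.
  by rewrite (_ : val j == val k = false) ?mulr0 ?addr0 //; apply/negbTE.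
have -> : f y - f z - (y - z) *m J =
    \sum_(k < m) (f (w k.+1) - f (w k) - (y - z) 0 k *: row k J).
  rewrite big_split /= sumrN mulmx_sum_row; congr (_ - _).
  rewrite -{1}wm -{1}w0 -(@telescope_sumr _ 0 m (fun k => f (w k))) //.
  by rewrite big_mkord.
apply: (le_trans (ler_norm_sum _ _ _)).
apply: (@le_trans _ _ (\sum_(k < m) e' * `|y - z|)).
  apply: ler_sum => k _; apply: (@le_trans _ _ (e' * `|(y - z) 0 k|)).
    rewrite wS rowK; apply: (@partial_increment _ _ f x k _ d).
    - by move=> u /Hd'[Uu _]; have [dU _] := D k; apply: dU; exact: mem_set.
    - by move=> u /Hd'[_]; exact.
    - exact: wx.
    - by rewrite -wS; exact: wx.
  by rewrite ler_wpM2l ?norm_coord // ltW.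
rewrite sumr_const card_ord -mulrnAl ler_wpM2r //.
rewrite /e' -mulr_natr -mulrA ler_piMr ?ltW // mulrC ltr_pdivrMr //.
by rewrite mul1r ltr_nat.
Unshelve. all: by end_near.
Qed.

Lemma strictly_differentiable_lipschitz m n (f : 'rV[R]_m -> 'rV[R]_n) x J :
  strictly_differentiable f x J ->
  exists L d, [/\ 0 < L, 0 < d &
    forall y z, `|y - x| < d -> `|z - x| < d -> `|f y - f z| <= L * `|y - z|].
Proof.
move=> /(_ 1 ltr01)[d d0 fd]; have [K K0 KJ] := norm_mulmx_le J.
exists (1 + K), d; split=> //; first by rewrite addr_gt0.
move=> y z yx zx; rewrite -[f y - f z](subrK ((y - z) *m J)) mulrDl.
by apply: le_trans (ler_normD _ _) _; rewrite lerD // fd.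
Qed.

(** Along a kernel vector v of the derivative, f (x + t v) would stay within
    o(t) of f x, against the lower bound on |f y - f x|. *)
Lemma strictly_differentiable_unitmx n (f : 'rV[R]_n -> 'rV[R]_n) x J (L d : R) :
  strictly_differentiable f x J -> 0 < L -> 0 < d ->
  (forall y, `|y - x| < d -> `|y - x| <= L * `|f y - f x|) ->
  J \in unitmx.
Proof.
move=> sd L0 d0 Lf; rewrite -row_free_unit -kermx_eq0; apply/negPn/negP.
case/rowV0Pn => v /sub_kermxP vJ v0.
have L20 : 0 < (L *+ 2)^-1 by rewrite invr_gt0 pmulrn_lgt0.
have [d' d'0 fd'] := sd _ L20.
have [q q0 /andP[qd qd']] := exists_pos_lt2 d0 d'0.
pose t := q / `|v|.
have nv : 0 < `|v| by rewrite normr_gt0.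
have t0 : 0 < t by rewrite divr_gt0.
have E : `|(x + t *: v) - x| = q.
  by rewrite addrC addKr normrZ gtr0_norm // divfK // gt_eqF.
have := fd' (x + t *: v) x; rewrite E subrr normr0 => /(_ qd' d'0).
have -> : (x + t *: v - x) *m J = 0.
  by rewrite addrC addKr -scalemxAl vJ scaler0.
rewrite subr0 => H.
have := Lf (x + t *: v); rewrite E => /(_ qd) H2.
have := le_trans H2 (ler_wpM2l (ltW L0) H).
rewrite mulrA -mulr_natr invfM mulrA mulfV ?gt_eqF // mul1r => H3.
by move: H3 q0; lra.
Qed.

End Calculus.

(** * Surjectivity in the inverse function theorem *)

Section InverseFunction.
Variable R : realType.

Lemma closed_ball_compact n (x : 'rV[R]_n) (e : R) :
  compact [set y | `|y - x| <= e].
Proof.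
apply: bounded_closed_compact.
  exists (`|x| + e); split; first by rewrite num_real.
  move=> M Me y /= yx; rewrite -[y](subrK x) addrC.
  by rewrite (le_trans (ler_normD _ _)) // (le_trans _ (ltW Me)) // lerD2l.
have -> : [set y | `|y - x| <= e] = (fun y => `|y - x|) @^-1` [set r : R | r <= e] by [].
apply: preimage_closed (@closed_le _ e) => y _.
apply: continuous_comp; last exact: norm_continuous.
by apply: continuousB => //; exact: cst_continuous.
Qed.

(** By compactness some y minimises the residual |(f y - z) J^-1| on a small
    closed ball. A Newton step from y stays in the ball and at least halves
    the residual, so the residual vanishes at y. *)
Lemma strictly_differentiable_surjective n (f : 'rV[R]_n -> 'rV[R]_n) x J (d : R) :
  strictly_differentiable f x J -> J \in unitmx -> 0 < d ->
  (forall y, `|y - x| < d -> {for y, continuous f}) ->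
  forall r, 0 < r -> exists2 e, 0 < e &
    forall z, `|z - f x| < e -> exists2 y, `|y - x| < r & f y = z.
Proof.
move=> sd Ju d0 fc r r0.
have [K K0 KJ] := norm_mulmx_le (invmx J).
have K20 : 0 < (2 * K)^-1 by rewrite invr_gt0 mulr_gt0.
have [d' d'0 fd'] := sd _ K20.
have [q1 q10 /andP[q1d q1d']] := exists_pos_lt2 d0 d'0.
have [q q0 /andP[qq1 qr]] := exists_pos_lt2 q10 r0.
have qd := lt_trans qq1 q1d; have qd' := lt_trans qq1 q1d'.
exists (q / (2 * K)); first by rewrite divr_gt0 // mulr_gt0.
move=> z zx.
(* Newton steps contract the residual (f y - z) J^-1 by a factor 1/2 *)
have newton y y' : `|y - x| <= q -> `|y' - x| <= q ->
    `|(f y - f y') *m invmx J - (y - y')| <= `|y - y'| / 2.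
  move=> yq y'q.
  have -> : (f y - f y') *m invmx J - (y - y') =
      (f y - f y' - (y - y') *m J) *m invmx J.
    by rewrite [RHS]mulmxBl mulmxK.
  apply: (le_trans (KJ _)).
  have := fd' y y' (le_lt_trans yq qd') (le_lt_trans y'q qd').
  move=> /(ler_wpM2l (ltW K0)) /le_trans; apply.
  rewrite mulrA invfM mulrCA mulfV ?gt_eqF // mulr1 mulrC.
  by rewrite lexx.
have resc : {within [set y | `|y - x| <= q],
    continuous (fun y => `|(f y - z) *m invmx J|)}.
  apply/continuous_in_subspaceT => y /set_mem /= yq.
  apply: continuous_comp; last exact: norm_continuous.
  apply: (@continuous_comp _ _ _ (fun y => f y - z) (fun u => u *m invmx J)).
    apply: (@continuousB _ _ _ f (cst z)); last exact: cst_continuous.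
    by apply: fc; exact: le_lt_trans qd.
  exact: continuous_mulmxr.
have [|y] := EVT_min_rV _ (@closed_ball_compact _ x q) resc.
  by exists x; rewrite /= subrr normr0 ltW.
move=> /set_mem /= yq ymin; exists y; first exact: le_lt_trans qr.
set w := (f y - z) *m invmx J in ymin.
have [w0|wN0] := eqVneq w 0.
  apply/eqP; rewrite -subr_eq0; apply/eqP.
  by rewrite -[f y - z]mulmx1 -(mulVmx Ju) mulmxA -/w w0 mul0mx.
have y'q : `|y - w - x| <= q.
  have -> : y - w - x = - ((f y - f x) *m invmx J - (y - x)) + (z - f x) *m invmx J.
    by rewrite /w !mulmxBl; apply/rowP => i; rewrite !mxE; ring.
  apply: (le_trans (ler_normD _ _)); rewrite normrN.
  have h1 : `|(f y - f x) *m invmx J - (y - x)| <= q / 2.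
    have xq : `|x - x| <= q by rewrite subrr normr0 ltW.
    by apply: le_trans (newton _ _ yq xq) _; rewrite ler_pM2r ?invr_gt0.
  have h2 : `|(z - f x) *m invmx J| <= q / 2.
    apply: (le_trans (KJ _)); move: zx; rewrite ltr_pdivlMr ?mulr_gt0 // => zx.
    by rewrite ler_pdivlMr // mulrC mulrA mulrC ltW.
  by move: h1 h2; lra.
have := ymin (y - w) (mem_set y'q).
have := newton (y - w) y y'q yq.
have -> : y - w - y = - w by rewrite addrC addKr.
have -> : (f (y - w) - f y) *m invmx J - - w = (f (y - w) - z) *m invmx J.
  by rewrite opprK /w -mulmxDl addrA subrK.
rewrite normrN => h1 h2; exfalso; move: wN0 (le_trans h2 h1).
by rewrite -normr_gt0; lra.
Qed.

End InverseFunction.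

(** * Box counting *)

Section BoxCounting.
Variable R : realType.

Lemma leq_expn2r a b k : (a <= b)%N -> (a ^ k <= b ^ k)%N.
Proof. by case: k => // k; rewrite leq_exp2r. Qed.

(** An upper box dimension at most k, witnessed by an explicit constant. It
    replaces measure zero: it grows by one under cones, and a set of box
    dimension less than n has empty interior in R^n. *)
Definition box_dim_le n (k : nat) (S : set 'rV[R]_n) :=
  exists C : nat, forall N, (0 < N)%N -> exists2 s : seq 'rV[R]_n,
    (size s <= C * N ^ k)%N &
    forall x, S x -> exists2 c, c \in s & `|x - c| <= N%:R^-1.

Lemma box_dim_le_sub n k (S S' : set 'rV[R]_n) :
  S `<=` S' -> box_dim_le k S' -> box_dim_le k S.
Proof.
move=> SS' [C H]; exists C => N /H[s sN sS]; exists s => // x /SS'; exact: sS.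
Qed.

Lemma box_dim_leU n k (S S' : set 'rV[R]_n) :
  box_dim_le k S -> box_dim_le k S' -> box_dim_le k (S `|` S').
Proof.
move=> [C H] [C' H']; exists (C + C')%N => N N0.
have [s sN sS] := H _ N0; have [s' sN' sS'] := H' _ N0.
exists (s ++ s'); first by rewrite size_cat mulnDl leq_add.
move=> x [/sS|/sS'] [c cs xc]; exists c => //; by rewrite mem_cat cs ?orbT.
Qed.

Lemma box_dim_le0 n k : box_dim_le k (@set0 'rV[R]_n).
Proof. by exists 0%N => N _; exists [::]. Qed.

Lemma box_dim_le_leq n k k' (S : set 'rV[R]_n) :
  (k <= k')%N -> box_dim_le k S -> box_dim_le k' S.
Proof.
move=> kk' [C H]; exists C => N N0; have [s sN sS] := H _ N0.
exists s => //; apply: (leq_trans sN); rewrite leq_mul2l.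
by rewrite leq_pexp2l ?orbT.
Qed.

Lemma box_dim_le_bigcup n k (I : choiceType) (D : set I) (F : I -> set 'rV[R]_n) :
  finite_set D -> (forall i, D i -> box_dim_le k (F i)) ->
  box_dim_le k (\bigcup_(i in D) F i).
Proof.
move=> /finite_seqP[s ->]; elim: s => [|i s IH] H.
  by rewrite (_ : \bigcup_(_ in _) _ = set0) ?bigcup0 //; exact: box_dim_le0.
apply: (@box_dim_le_sub _ _ _ (F i `|` \bigcup_(j in [set` s]) F j)).
  move=> x [j /=]; rewrite inE => /orP[/eqP->|js] Fx; first by left.
  by right; exists j.
apply: box_dim_leU; first by apply: H; rewrite /= mem_head.
by apply: IH => j js; apply: H; rewrite /= inE (_ : j \in s) ?orbT.
Qed.

(** Split the cube into about N^l small cubes of side proportional to 1/N. *)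
Lemma box_dim_le_lipschitz l n (f : 'rV[R]_l -> 'rV[R]_n) x (d L : R) :
  0 < d -> 0 < L ->
  (forall y z, `|y - x| <= d -> `|z - x| <= d -> `|f y - f z| <= L * `|y - z|) ->
  box_dim_le l (f @` [set y | `|y - x| <= d]).
Proof.
move=> d0 L0 fL.
pose K := (truncn (2 * d * L)).+1.
have KE : 2 * d * L <= K%:R.
  by rewrite ltW // truncnS_gt.
exists ((2 * K) ^ l)%N => N N0.
pose P := (K * N)%N.
have P0 : (0 < P)%N by rewrite muln_gt0.
have PR : 0 < P%:R :> R by rewrite ltr0n.
pose node (j : {ffun 'I_l -> 'I_P.+1}) : 'rV[R]_l :=
  \row_i (x 0 i - d + 2 * d * ((j i)%:R / P%:R)).
exists [seq f (node j) | j : {ffun 'I_l -> 'I_P.+1}].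
  rewrite size_map -cardE card_ffun !card_ord -expnMn leq_expn2r //.
  by rewrite mul2n -addnn mulnDl -/P -addn1 leq_add2l.
move=> _ [y /= yx <-].
pose t i := ((y 0 i - x 0 i + d) / (2 * d) * P%:R).
have yxi i : `|y 0 i - x 0 i| <= d.
  by apply: le_trans yx; have := norm_coord (y - x) i; rewrite !mxE.
have t0 i : 0 <= t i.
  have := yxi i; rewrite ler_norml => /andP[h _].
  by rewrite mulr_ge0 // divr_ge0 //; lra.
have tP i : t i <= P%:R.
  have := yxi i; rewrite ler_norml => /andP[_ h].
  by rewrite ler_piMl // ler_pdivrMr //; lra.
pose j : {ffun 'I_l -> 'I_P.+1} := [ffun i => inord (truncn (t i))].
have jE i : (j i : nat) = truncn (t i).
  rewrite ffunE inordK // ltnS -(ler_nat R); apply: le_trans (tP i).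
  by rewrite truncn_le.
exists (f (node j)); first by apply: map_f; rewrite mem_enum.
have close i : `|y 0 i - (node j) 0 i| <= 2 * d / P%:R.
  have := truncn_itv (t0 i); rewrite mxE -jE.
  set u := (j i)%:R; rewrite -natr1 -/u => /andP[h1 h2].
  have yE : y 0 i = x 0 i - d + 2 * d * (t i / P%:R).
    by rewrite /t; field; rewrite !gt_eqF.
  rewrite yE (_ : _ - _ = 2 * d * ((t i - u) / P%:R)); last by field; rewrite gt_eqF.
  rewrite normrM normrM [ `|2 * d|]gtr0_norm ?mulr_gt0 // [ `|P%:R^-1|]gtr0_norm ?invr_gt0 //.
  have dd : 0 <= 2 * d by rewrite mulr_ge0 // ltW.
  rewrite mulrA ler_pM2r ?invr_gt0 // ler_piMr // ler_norml.
  by move: h1 h2; set tt := t i; move=> h1 h2; apply/andP; split; lra.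
have nd : `|node j - x| <= d.
  apply: norm_rV_le => [|i]; first exact: ltW.
  rewrite !mxE.
  have j0 : 0 <= (j i)%:R / P%:R :> R by rewrite divr_ge0.
  have j1 : (j i)%:R / P%:R <= 1 :> R.
    by rewrite ler_pdivrMr // mul1r ler_nat -ltnS.
  have := mulr_ge0 (ltW d0) j0; have := ler_wpM2l (ltW d0) j1.
  set u := _ / P%:R => h1 h2; rewrite ler_norml; apply/andP; split; lra.
apply: le_trans (fL _ _ yx nd) _.
apply: (@le_trans _ _ (L * (2 * d / P%:R))).
  rewrite (ler_wpM2l (ltW L0)) //; apply: norm_rV_le => [|i].
    by rewrite divr_ge0 // mulr_ge0 // ltW.
  by have := close i; rewrite !mxE.
rewrite /P natrM invfM !mulrA ler_piMl ?invr_ge0 // ler_pdivrMr ?ltr0n //.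
by rewrite mul1r (_ : L * 2 * d = 2 * d * L) //; ring.
Qed.

(** Discretising the factor t costs one more power of N. *)
Lemma box_dim_le_cone n k (S : set 'rV[R]_n) (a : 'rV[R]_n) (D T : nat) :
  box_dim_le k S -> (forall x, S x -> `|x - a| <= D%:R) ->
  box_dim_le k.+1 [set y | exists x t, [/\ S x, 0 <= t, t <= T%:R &
                                         y = a + t *: (x - a)]].
Proof.
move=> [C H] SD.
exists ((T.+1 * (2 * D.+1)).+1 * (C * (2 * T.+1) ^ k))%N => N N0.
have N'0 : (0 < 2 * T.+1 * N)%N by rewrite !muln_gt0 N0.
have [s sN sS] := H _ N'0.
pose Q := (2 * D.+1 * N)%N.
have Q0 : (0 < Q)%N by rewrite !muln_gt0 N0.
have QR : 0 < Q%:R :> R by rewrite ltr0n.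
exists [seq a + (j%:R / Q%:R) *: (c - a) | j <- iota 0 (T.+1 * Q).+1, c <- s].
  rewrite size_allpairs size_iota.
  apply: leq_trans (leq_mul (leqnn _) sN) _.
  rewrite expnMn expnS !mulnA.
  rewrite [leqRHS](_ : _ = (T.+1 * (2 * D.+1)).+1 * N * (C * (2 * T.+1) ^ k * N ^ k))%N.
    rewrite !mulnA -!(mulnA _ C) !mulnA leq_mul2r; apply/orP; right.
    rewrite leq_mul2r; apply/orP; right; rewrite leq_mul2r; apply/orP; right.
    by rewrite mulSn -[X in (X <= _)%N]add1n leq_add2r.
  by rewrite -!mulnA; congr (_ * _)%N; rewrite [RHS]mulnC -!mulnA [(_ ^ k * N)%N]mulnC.
move=> _ [x [t [Sx t0 tT ->]]].
have [c cs xc] := sS _ Sx.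
pose j := truncn (t * Q%:R).
have tQ0 : 0 <= t * Q%:R by rewrite mulr_ge0.
have := truncn_itv tQ0; rewrite -/j -natr1 => /andP[h1 h2].
have jT : (j < (T.+1 * Q).+1)%N.
  rewrite ltnS -(ler_nat R) natrM; apply: le_trans h1 _.
  by rewrite ler_pM2r // (le_trans tT) // ler_nat.
exists (a + (j%:R / Q%:R) *: (c - a)).
  by apply/allpairsP; exists (j, c); split => //=;
    rewrite -[0%N :: _]/(iota 0 (T.+1 * Q).+1) mem_iota add0n.
set u := j%:R / Q%:R.
have ut : `|t - u| <= Q%:R^-1.
  have -> : t - u = (t * Q%:R - j%:R) / Q%:R by rewrite /u mulrBl mulfK // gt_eqF.
  rewrite normrM [ `|_^-1|]ger0_norm ?invr_ge0 // ler_piMl ?invr_ge0 //.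
  by rewrite ler_norml; apply/andP; split; lra.
have u0 : 0 <= u by rewrite divr_ge0.
have uT : u <= T.+1%:R.
  by rewrite ler_pdivrMr // -natrM ler_nat -ltnS.
have -> : a + t *: (x - a) - (a + u *: (c - a)) = (t - u) *: (x - a) + u *: (x - c).
  by apply/rowP => i; rewrite !mxE; ring.
apply: (le_trans (ler_normD _ _)); clearbody u.
rewrite !normrZ (ger0_norm u0).
have NR : N%:R != 0 :> R by rewrite pnatr_eq0 -lt0n.
have -> : N%:R^-1 = Q%:R^-1 * D.+1%:R + T.+1%:R * (2 * T.+1 * N)%:R^-1 :> R.
  have split (p q r : R) : p != 0 -> q != 0 -> r != 0 ->
      r^-1 = (2 * p * r)^-1 * p + q * (2 * q * r)^-1.
    by move=> p0 q0 r0; field; rewrite p0 q0 r0.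
  by rewrite /Q !natrM; apply: split => //; rewrite pnatr_eq0.
apply: lerD; apply: ler_pM => //.
by apply: le_trans (SD _ Sx) _; rewrite ler_nat.
Qed.

(** A ball of R^n contains M^n grid points with mutual distances more than
    2 / (K M), and a box of radius 1 / (K M) holds at most one of them. Hence
    M^n <= C (K M)^k, which fails for large M when k < n. *)
Lemma box_dim_le_ball n k (S : set 'rV[R]_n) (a : 'rV[R]_n) (r : R) :
  box_dim_le k S -> (k < n)%N -> 0 < r -> ~ [set x | `|x - a| <= r] `<=` S.
Proof.
move=> [C H] kn r0 rS.
pose K := (truncn (2 / r)).+1.
have KE : 2 / r < K%:R by exact: truncnS_gt.
pose M := (C * K ^ k).+1.
have M0 : (0 < M)%N by [].
have MR : 0 < M%:R :> R by rewrite ltr0n.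
have KM0 : (0 < K * M)%N by [].
have [s sN sS] := H _ KM0.
pose pt (j : {ffun 'I_n -> 'I_M}) : 'rV[R]_n := a + \row_i (r * ((j i)%:R / M%:R)).
have ptS j : S (pt j).
  apply: rS; rewrite /pt /= addrC addKr; apply: norm_rV_le => [|i]; first exact: ltW.
  rewrite mxE ger0_norm; last by rewrite mulr_ge0 ?divr_ge0 // ltW.
  by rewrite ler_piMr ?(ltW r0) // ler_pdivrMr // mul1r ler_nat ltnW.
have /choice[c cP] : forall j, exists c, c \in s /\ `|pt j - c| <= (K * M)%:R^-1.
  by move=> j; have [c cs cp] := sS _ (ptS j); exists c.
have cinj : injective c.
  move=> j j' cc; apply/ffunP => i; apply/val_inj/eqP; rewrite eqn_leq.
  have close : `|(pt j - pt j') 0 i| <= 2 / (K * M)%:R.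
    have -> : pt j - pt j' = (pt j - c j) - (pt j' - c j').
      by rewrite cc opprB addrA subrK.
    apply: le_trans (norm_coord _ _) _; apply: le_trans (ler_normB _ _) _.
    by rewrite mulrDl mul1r lerD //; case: (cP j) (cP j') => ? ? [].
  have {}close : `|(j i)%:R - (j' i)%:R| < 1 :> R.
    have E : (pt j - pt j') 0 i = r / M%:R * ((j i)%:R - (j' i)%:R).
      by rewrite !mxE; ring.
    move: close; rewrite E normrM gtr0_norm ?divr_gt0 //.
    rewrite mulrC -ler_pdivlMr ?divr_gt0 // => /le_lt_trans; apply.
    rewrite natrM invf_div invfM !mulrA mulfVK ?gt_eqF //.
    rewrite mulrAC ltr_pdivrMr ?ltr0n // mul1r.
    exact: KE.
  have abs (p q : nat) : `|p%:R - q%:R| < 1 :> R -> (p <= q)%N.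
    rewrite ltr_norml => /andP[_]; rewrite ltrBlDr nat1r ltr_nat.
    by rewrite ltnS.
  by rewrite !abs // distrC.
have : (M ^ n <= size s)%N.
  have -> : (M ^ n = #|{ffun 'I_n -> 'I_M}|)%N by rewrite card_ffun !card_ord.
  rewrite cardE -(size_map c); apply: uniq_leq_size.
    by rewrite map_inj_uniq // enum_uniq.
  by move=> _ /mapP[j _ ->]; case: (cP j).
move=> /leq_trans /(_ sN); apply/negP; rewrite -ltnNge.
apply: (@leq_trans (M ^ k.+1)); last by rewrite leq_pexp2l.
by rewrite expnMn mulnA expnS ltn_mul2r expn_gt0 M0 /= /M.
Qed.

Lemma box_dim_le_C1_image l n (W A : set 'rV[R]_l) (f : 'rV[R]_l -> 'rV[R]_n) :
  open W -> A `<=` W -> compact A -> Ck_on 1 W f -> box_dim_le l (f @` A).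
Proof.
move=> oW AW cA fW.
have loc x : A x -> exists2 d : R, 0 < d &
    box_dim_le l (f @` [set y | `|y - x| <= d]).
  move=> /AW Wx; have [J sJ] := C1_strictly_differentiable oW Wx fW.
  have [L [d [L0 d0 fL]]] := strictly_differentiable_lipschitz sJ.
  have d20 : 0 < d / 2 by rewrite divr_gt0.
  have dd : d / 2 < d by move: d0; lra.
  exists (d / 2) => //; apply: (box_dim_le_lipschitz d20 L0) => y z yx zx.
  by apply: fL; exact: le_lt_trans dd.
have /choice[d dP] : forall x, exists d : R, A x -> 0 < d /\
    box_dim_le l (f @` [set y | `|y - x| <= d]).
  move=> x; have [Ax|nAx] := pselect (A x); last by exists 0.
  by have [d ? ?] := loc _ Ax; exists d.
move: cA; rewrite compact_cover => /(_ _ A (fun x => ball x (d x))).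
case=> [x Ax||D DA].
- exact: ball_open.
- by move=> x Ax; exists x => //; apply: ballxx; case: (dP _ Ax).
move=> Acov.
have sub : f @` A `<=` \bigcup_(x in [set` D]) (f @` [set y | `|y - x| <= d x]).
  move=> _ [y /Acov[x /= xD xy] <-]; exists x => //; exists y => //=.
  by move: xy; rewrite -ball_normE /= distrC => /ltW.
apply: (box_dim_le_sub sub).
apply: box_dim_le_bigcup => // x /= xD; have /set_mem Ax := DA _ xD.
by case: (dP _ Ax).
Qed.

End BoxCounting.

(** * Barycentric coordinates *)

Section SimplexGeometry.
Variable R : realType.

Lemma cvg_rV n (T : Type) (F : set_system T) (FF : Filter F)
    (f : T -> 'rV[R]_n) (a : 'rV[R]_n) :
  (forall i, (f x 0 i) @[x --> F] --> a 0 i) -> f @ F --> a.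
Proof.
move=> fa; apply/cvgrPdist_le => e e0.
have : \forall x \near F, forall i, `|a 0 i - f x 0 i| <= e.
  apply: filter_forall => i; have /cvgrPdist_le := fa i; exact.
apply: filter_app; apply: nearW => x H.
by apply: norm_rV_le => [|i]; [exact: ltW | have := H i; rewrite !mxE].
Qed.

Lemma continuous_rV n (T : topologicalType) (f : T -> 'rV[R]_n) (a : T) :
  (forall i, {for a, continuous (fun x => f x 0 i)}) -> {for a, continuous f}.
Proof. exact: (cvg_rV (nbhs_filter a)). Qed.

Lemma bary_sum1 l (x : 'rV[R]_l) : \sum_i barycentric x i = 1.
Proof.
rewrite big_ord_recl (eq_bigr (fun j => x 0 j)) => [|j _].
  by rewrite /barycentric unlift_none subrK.
by rewrite /barycentric liftK.
Qed.

Lemma bary_lift0 l (x : 'rV[R]_l) j : barycentric x (lift ord0 j) = x 0 j.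
Proof. by rewrite /barycentric liftK. Qed.

Lemma bary_ord0 l (x : 'rV[R]_l) : barycentric x ord0 = 1 - \sum_j x 0 j.
Proof. by rewrite /barycentric unlift_none. Qed.

Lemma bary_inj l (x y : 'rV[R]_l) : barycentric x =1 barycentric y -> x = y.
Proof.
by move=> xy; apply/rowP => j; have := xy (lift ord0 j); rewrite !bary_lift0.
Qed.

Lemma simplexP l (x : 'rV[R]_l) :
  simplex R l x <-> forall i, 0 <= barycentric x i.
Proof.
split=> [[x01 x1] i|x0].
  case: (unliftP ord0 i) => [j|] ->; last by rewrite bary_ord0 subr_ge0.
  by rewrite bary_lift0; have /andP[] := x01 j.
have x0' j : 0 <= x 0 j by rewrite -bary_lift0.
have x1 : \sum_j x 0 j <= 1 by rewrite -subr_ge0 -bary_ord0.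
split=> // j; rewrite x0' /=; apply: le_trans x1.
by rewrite (bigD1 j) //= lerDl sumr_ge0.
Qed.

Lemma sum_coord_continuous l : continuous (fun x : 'rV[R]_l => \sum_j x 0 j).
Proof.
have -> : (fun x : 'rV[R]_l => \sum_j x 0 j) =
    (fun M : 'rV[R]_1 => M 0 0) \o (fun x => x *m const_mx 1).
  apply/funext => x /=; rewrite mxE.
  by apply: eq_bigr => j _; rewrite mxE mulr1.
move=> x; apply: continuous_comp; first exact: continuous_mulmxr.
exact: coord_continuous.
Qed.

Lemma bary_continuous l (i : 'I_l.+1) :
  continuous (fun x : 'rV[R]_l => barycentric x i).
Proof.
move=> x; case: (unliftP ord0 i) => [j|] ->.
  have -> : (fun y : 'rV[R]_l => barycentric y (lift ord0 j)) = (fun y => y 0 j).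
    by apply/funext => y; rewrite bary_lift0.
  exact: coord_continuous.
have -> : (fun y : 'rV[R]_l => barycentric y ord0) = (fun y => 1 - \sum_j y 0 j).
  by apply/funext => y; rewrite bary_ord0.
apply: (@continuousB _ _ _ (cst (1 : R)) (fun y : 'rV[R]_l => \sum_j y 0 j)).
  exact: cst_continuous.
exact: sum_coord_continuous.
Qed.

Lemma bary_affine l (x y : 'rV[R]_l) (t : R) i :
  barycentric ((1 - t) *: x + t *: y) i =
  (1 - t) * barycentric x i + t * barycentric y i.
Proof.
case: (unliftP ord0 i) => [j|] ->; first by rewrite !bary_lift0 !mxE.
rewrite !bary_ord0; under eq_bigr do rewrite !mxE.
by rewrite big_split /= -!mulr_sumr; ring.
Qed.

Definition center l : 'rV[R]_l := const_mx (l.+1%:R^-1).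

Lemma bary_center l i : barycentric (center l) i = l.+1%:R^-1.
Proof.
case: (unliftP ord0 i) => [j|] ->; first by rewrite bary_lift0 mxE.
rewrite bary_ord0; under eq_bigr do rewrite mxE.
rewrite sumr_const card_ord -mulr_natr -[l.+1%:R]natr1.
by field; rewrite natr1 pnatr_eq0.
Qed.

Lemma affine_continuous l (x y : 'rV[R]_l) :
  continuous (fun t : R => (1 - t) *: x + t *: y).
Proof.
move=> t; apply: cvgD; apply: cvgZ; try exact: cvg_cst.
  by apply: cvgB; [exact: cvg_cst | exact: cvg_id].
exact: cvg_id.
Qed.

Lemma simplex_interiorP l (x : 'rV[R]_l) :
  (simplex R l)° x <-> forall i, 0 < barycentric x i.
Proof.
split=> [|x0]; last first.
  have oP : \forall y \near x, forall i, 0 < barycentric y i.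
    apply: (filter_forall (nbhs_filter x)) => i; apply: (@bary_continuous _ i x [set r | 0 < r]).
    by apply: open_nbhs_nbhs; split; [exact: open_gt | exact: x0].
  apply: filterS oP => y y0; apply/simplexP => i; exact: ltW.
move=> xi i; rewrite lt_neqAle; have := interior_subset xi.
move=> /simplexP/(_ i) ->; rewrite andbT; apply/negP => /eqP i0.
(* pushing x slightly away from the barycenter keeps it in the simplex *)
have := @affine_continuous l x (center l) 0.
rewrite /continuous_at subr0 scale0r scale1r addr0 => /(_ _ xi).
move=> /nbhs_ballP[e /= e0 /(_ (- (e / 2)))].
rewrite /ball /= sub0r opprK gtr0_norm ?divr_gt0 // => /(_ ltac:(by move: e0; lra)).
rewrite -{1}(opprK (e / 2)) => /simplexP/(_ i);
rewrite bary_affine bary_center -i0 mulr0 add0r mulNr oppr_ge0.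
by rewrite leNgt mulr_gt0 ?divr_gt0 ?invr_gt0.
Qed.

Lemma simplex_closed l : closed (simplex R l).
Proof.
have -> : simplex R l = \bigcap_i [set x | 0 <= barycentric x i].
  apply/seteqP; split=> x; first by move/simplexP => H i _; exact: H.
  by move=> H; apply/simplexP => i; exact: H.
apply: closed_bigI => i _.
apply: (@preimage_closed _ _ (fun x => barycentric x i) [set r : R | 0 <= r]).
  by move=> x _; exact: bary_continuous.
exact: closed_ge.
Qed.

Lemma simplex_norm l (x : 'rV[R]_l) : simplex R l x -> `|x| <= 1.
Proof.
by move=> [x01 _]; apply: norm_rV_le => // i; have /andP[? ?] := x01 i; rewrite ger0_norm.
Qed.

Lemma simplex_compact l : compact (simplex R l).
Proof.
apply: bounded_closed_compact; last exact: simplex_closed.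
exists 1; split; first by rewrite num_real.
by move=> M M1 x /simplex_norm /le_trans; apply; exact: ltW.
Qed.

Lemma simplex_interior_open l : open (simplex R l)°.
Proof. exact: open_interior. Qed.

Lemma center_interior l : (simplex R l)° (center l).
Proof. by apply/simplex_interiorP => i; rewrite bary_center invr_gt0. Qed.

Lemma simplex_interior_dense l (x : 'rV[R]_l) (U : set 'rV[R]_l) :
  simplex R l x -> nbhs x U -> exists2 y, U y & (simplex R l)° y.
Proof.
move=> sx Ux; have := @affine_continuous l x (center l) 0.
rewrite /continuous_at subr0 scale0r scale1r addr0 => /(_ _ Ux).
move=> /nbhs_ballP[e /= e0 eU].
have [q q0 /andP[qe q1]] := exists_pos_lt2 e0 (@ltr01 R).
exists ((1 - q) *: x + q *: center l).
  by apply: eU; rewrite /ball /= sub0r normrN gtr0_norm.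
apply/simplex_interiorP => i; rewrite bary_affine bary_center.
move/simplexP: sx => /(_ i) x0.
by apply: ltr_wpDl; [rewrite mulr_ge0 // subr_ge0 ltW | rewrite mulr_gt0 ?invr_gt0].
Qed.

Definition of_bary l (b : 'I_l.+1 -> R) : 'rV[R]_l := \row_j b (lift ord0 j).

Lemma of_baryK l (b : 'I_l.+1 -> R) :
  \sum_i b i = 1 -> barycentric (of_bary b) =1 b.
Proof.
move=> b1 i; case: (unliftP ord0 i) => [j|] ->; first by rewrite bary_lift0 mxE.
rewrite bary_ord0; under eq_bigr do rewrite mxE.
by rewrite -b1 big_ord_recl addrK.
Qed.

(** An affine automorphism of the simplex that carries the origin to the
    vertex i, hence the facet where the coordinates sum to 1 to the facet
    opposite to i. It puts any given facet in the same standard position. *)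
Definition corner_map l (i : 'I_l.+1) (x : 'rV[R]_l) : 'rV[R]_l :=
  of_bary (fun j => if unlift i j is Some k then x 0 k else 1 - \sum_k x 0 k).

Definition corner_coord l (i : 'I_l.+1) (y : 'rV[R]_l) : 'rV[R]_l :=
  \row_k barycentric y (lift i k).

Lemma bary_corner l (i : 'I_l.+1) x j : barycentric (corner_map i x) j =
  if unlift i j is Some k then x 0 k else 1 - \sum_k x 0 k.
Proof.
rewrite of_baryK // (bigD1_ord i) //= unlift_none.
by rewrite [X in _ + X](eq_bigr (fun k => x 0 k)) ?subrK // => k _; rewrite liftK.
Qed.

Lemma bary_corner_self l (i : 'I_l.+1) x :
  barycentric (corner_map i x) i = 1 - \sum_k x 0 k.
Proof. by rewrite bary_corner unlift_none. Qed.

Lemma bary_corner_lift l (i : 'I_l.+1) x k :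
  barycentric (corner_map i x) (lift i k) = x 0 k.
Proof. by rewrite bary_corner liftK. Qed.

Lemma corner_coordK l (i : 'I_l.+1) : cancel (corner_coord i) (corner_map i).
Proof.
move=> y; apply: bary_inj => j; case: (unliftP i j) => [k|] ->.
  by rewrite bary_corner_lift mxE.
rewrite bary_corner_self; under eq_bigr do rewrite mxE.
by rewrite -(bary_sum1 y) (bigD1_ord i) //= addrK.
Qed.

Lemma corner_mapK l (i : 'I_l.+1) : cancel (corner_map i) (corner_coord i).
Proof. by move=> x; apply/rowP => k; rewrite mxE bary_corner_lift. Qed.

Lemma corner_map_continuous l (i : 'I_l.+1) : continuous (corner_map i).
Proof.
move=> x; apply: continuous_rV => k.
have E y : corner_map i y 0 k = (if unlift i (lift ord0 k) is Some j
    then barycentric y (lift ord0 j) else barycentric y ord0).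
  by rewrite mxE; case: unlift => [j|]; rewrite ?bary_lift0 ?bary_ord0.
have -> : (fun y => corner_map i y 0 k) = (fun y => if unlift i (lift ord0 k) is Some j
    then barycentric y (lift ord0 j) else barycentric y ord0) by apply/funext.
by case: unlift => [j|]; exact: bary_continuous.
Qed.

Lemma corner_map_simplex l (i : 'I_l.+1) x :
  simplex R l (corner_map i x) <-> simplex R l x.
Proof.
split=> /simplexP H; apply/simplexP => j.
  case: (unliftP ord0 j) => [k|] ->; rewrite ?bary_lift0 ?bary_ord0.
    by have := H (lift i k); rewrite bary_corner_lift.
  by have := H i; rewrite bary_corner_self.
case: (unliftP i j) => [k|] ->.
  by rewrite bary_corner_lift -bary_lift0.
by rewrite bary_corner_self -bary_ord0.
Qed.

Lemma corner_map_interior l (i : 'I_l.+1) x :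
  (simplex R l)° (corner_map i x) <-> (simplex R l)° x.
Proof.
split=> /simplex_interiorP H; apply/simplex_interiorP => j.
  case: (unliftP ord0 j) => [k|] ->; rewrite ?bary_lift0 ?bary_ord0.
    by have := H (lift i k); rewrite bary_corner_lift.
  by have := H i; rewrite bary_corner_self.
case: (unliftP i j) => [k|] ->.
  by rewrite bary_corner_lift -bary_lift0.
by rewrite bary_corner_self -bary_ord0.
Qed.

Lemma face_map_corner l (i : 'I_l.+2) (z : 'rV[R]_l) :
  face_map i z = corner_map i (\row_k barycentric z k).
Proof.
have vE m (p : 'I_m.+2) (k : 'I_m.+1) : vertex R p 0 k = (p == lift ord0 k)%:R.
  by rewrite -bary_lift0 barycentric_vertex eq_sym.
apply/rowP => k; rewrite /face_map summxE mxE.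
under eq_bigr do rewrite mxE vE.
case: (unliftP i (lift ord0 k)) => [j|] E.
  rewrite (bigD1 j) //= E eqxx mulr1 big1 ?addr0 ?mxE // => j' jj'.
  by rewrite (inj_eq lift_inj) (negbTE jj') mulr0.
rewrite big1 => [|j _]; last by rewrite E eq_sym (negbTE (neq_lift _ _)) mulr0.
by under eq_bigr do rewrite mxE; rewrite bary_sum1 subrr.
Qed.

Lemma bary_face_self l (i : 'I_l.+2) (z : 'rV[R]_l) :
  barycentric (face_map i z) i = 0.
Proof.
rewrite face_map_corner bary_corner_self; under eq_bigr do rewrite mxE.
by rewrite bary_sum1 subrr.
Qed.

Lemma bary_face_lift l (i : 'I_l.+2) (z : 'rV[R]_l) k :
  barycentric (face_map i z) (lift i k) = barycentric z k.
Proof. by rewrite face_map_corner bary_corner_lift mxE. Qed.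

Lemma face_map_surj l (i : 'I_l.+2) (x : 'rV[R]_l.+1) :
  simplex R l.+1 x -> barycentric x i = 0 ->
  exists y, [/\ simplex R l y, face_map i y = x &
    forall k, barycentric y k = barycentric x (lift i k)].
Proof.
move=> /simplexP sx xi0.
pose b k := barycentric x (lift i k).
have b1 : \sum_k b k = 1 by rewrite -(bary_sum1 x) (bigD1_ord i) //= xi0 add0r.
have E k : barycentric (of_bary b) k = barycentric x (lift i k) by rewrite of_baryK.
exists (of_bary b); split=> //; first by apply/simplexP => k; rewrite E.
apply: bary_inj => j; case: (unliftP i j) => [k|] ->.
  by rewrite bary_face_lift E.
by rewrite bary_face_self xi0.
Qed.

End SimplexGeometry.

(** * Homeomorphisms between subsets *)

Section Topology.

Lemma homeomorphic_trans (X Y Z : topologicalType) (A : set X) (B : set Y)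
    (C : set Z) :
  homeomorphic A B -> homeomorphic B C -> homeomorphic A C.
Proof.
move=> [f [g [fK gK cf cg]]] [f' [g' [fK' gK' cf' cg']]].
exists (f' \o f), (g \o g'); split.
- exact: can_comp.
- exact: can_comp.
- by move=> x; apply: continuous_comp; [exact: cf | exact: cf'].
- by move=> x; apply: continuous_comp; [exact: cg' | exact: cg].
Qed.

Lemma restrict_continuous (X Y : topologicalType) (A : set X) (B : set Y)
    (f : X -> Y) (F : A -> B) :
  (forall a, set_val (F a) = f (set_val a)) ->
  (forall x, A x -> forall N, nbhs (f x) N -> \forall y \near x, A y -> N (f y)) ->
  continuous F.
Proof.
move=> Ff fc a N [/= _ [[W oW <-] Wa] WN].
have := fc _ (set_valP a) W; rewrite -Ff.
move=> /(_ (open_nbhs_nbhs (conj oW Wa))) V.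
have V' : nbhs a (fun b : A => A (set_val b) -> W (f (set_val b))).
  exact: @initial_continuous _ _ set_val a _ V.
apply: filterS V' => b /(_ (set_valP b)) Wb.
by apply: WN; rewrite /= Ff.
Qed.

(** Total functions between the ambient spaces are easier to paste than
    functions between subtypes; continuity is only asked along A and B. *)
Lemma homeomorphic_of (X Y : topologicalType) (A : set X) (B : set Y)
    (f : X -> Y) (g : Y -> X) :
  (forall x, A x -> B (f x)) -> (forall y, B y -> A (g y)) ->
  (forall x, A x -> g (f x) = x) -> (forall y, B y -> f (g y) = y) ->
  (forall x, A x -> forall N, nbhs (f x) N -> \forall y \near x, A y -> N (f y)) ->
  (forall y, B y -> forall N, nbhs (g y) N -> \forall z \near y, B z -> N (g z)) ->
  homeomorphic A B.
Proof.
move=> AB BA gf fg cf cg.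
pose F (a : A) : B := exist (fun y => y \in B) _ (mem_set (AB _ (set_valP a))).
pose G (b : B) : A := exist (fun x => x \in A) _ (mem_set (BA _ (set_valP b))).
exists F, G; split.
- by move=> a; apply/val_inj; exact: gf (set_valP a).
- by move=> b; apply/val_inj; exact: fg (set_valP b).
- exact: restrict_continuous cf.
- exact: restrict_continuous cg.
Qed.

(** The inverse of a continuous injection of a compact set into a Hausdorff
    space is continuous: the image of the points of K outside the interior of
    U is closed and misses f x. *)
Lemma compact_inverse_nbhs (X Y : topologicalType) (K : set X) (f : X -> Y) x U :
  hausdorff_space Y -> compact K -> {within K, continuous f} ->
  {in K &, injective f} -> K x -> nbhs x U ->
  \forall q \near f x, forall z, K z -> f z = q -> U z.
Proof.
move=> hY cK cf finj Kx Ux.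
have cKU : compact (K `&` ~` U°).
  apply: compact_closedI => //; apply: open_closedC; exact: open_interior.
have cl : closed (f @` (K `&` ~` U°)).
  apply: compact_closed => //; apply: continuous_compact => //.
  by apply: continuous_subspaceW cf => z [].
have : (~` (f @` (K `&` ~` U°))) (f x).
  move=> [z [Kz zU] fzx]; apply: zU.
  by rewrite (finj _ _ (mem_set Kz) (mem_set Kx) fzx).
move=> nfx; have := open_nbhs_nbhs (conj (closed_openC cl) nfx).
apply: filterS => q nq z Kz fzq; apply: contrapT => nUz; apply: nq.
by exists z => //; split=> // /interior_subset.
Qed.

Lemma within_nbhs (X Y : topologicalType) (K : set X) (f : X -> Y) x N :
  {within K, continuous f} -> K x -> nbhs (f x) N ->
  \forall z \near x, K z -> N (f z).
Proof. by move=> /subspace_continuousP cf Kx fN; exact: cf Kx _ fN. Qed.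

End Topology.

(** * A radial map of the orthant onto an open simplex *)

Section RadialFunctions.
Variable R : realType.
Implicit Types m t : R.

(** [pushr m] is an increasing bijection of ]0, +oo[ onto ]0, 1 + m[, with
    inverse [pullr m]. Both are the identity up to 1; beyond 1, [pushr] is the
    Moebius map t |-> 1 + m - m / t. Writing them with minima and maxima makes
    their continuity immediate. *)
Definition pushr m t := Num.min t 1 + m * (1 - (Num.max t 1)^-1).
Definition pullr m t := Num.min t 1 - 1 + m / (1 + m - Num.max t 1).

Lemma pushr_small m t : t <= 1 -> pushr m t = t.
Proof. by move=> t1; rewrite /pushr min_l // max_r // invr1 subrr mulr0 addr0. Qed.

Lemma pullr_small m t : 0 < m -> t <= 1 -> pullr m t = t.
Proof.
move=> m0 t1; rewrite /pullr min_l // max_r // (_ : 1 + m - 1 = m); last by ring.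
by rewrite divff ?gt_eqF // subrK.
Qed.

Lemma pushr_large m t : 1 <= t -> pushr m t = 1 + m - m / t.
Proof. by move=> t1; rewrite /pushr min_r // max_l // mulrBr mulr1 addrA. Qed.

Lemma pullr_large m t : 1 <= t -> pullr m t = m / (1 + m - t).
Proof. by move=> t1; rewrite /pullr min_r // max_l // subrr add0r. Qed.

Lemma pushr_itv m t : 0 < m -> 0 < t -> 0 < pushr m t < 1 + m.
Proof.
move=> m0 t0; have [t1|t1] := leP t 1; first by rewrite pushr_small // t0 /=; lra.
rewrite pushr_large ?ltW //.
have := divr_gt0 m0 t0; have : m / t <= m by rewrite ler_piMr ?ltW // invf_lt1.
by set q := m / t => q1 q0; apply/andP; split; lra.
Qed.

Lemma pushrK m t : 0 < m -> 0 < t -> pullr m (pushr m t) = t.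
Proof.
move=> m0 t0; have [t1|/ltW t1] := leP t 1; first by rewrite pushr_small ?pullr_small.
rewrite pushr_large // pullr_large.
  by rewrite opprB addrC subrK invf_div mulrC divfK // gt_eqF.
have : m / t <= m by rewrite ler_piMr ?(ltW m0) // invf_le1.
lra.
Qed.

Lemma pullr_gt0 m t : 0 < m -> 0 < t -> t < 1 + m -> 0 < pullr m t.
Proof.
move=> m0 t0 tm; have [t1|/ltW t1] := leP t 1; first by rewrite pullr_small.
by rewrite pullr_large // divr_gt0 // subr_gt0.
Qed.

Lemma pullrK m t : 0 < m -> 0 < t -> t < 1 + m -> pushr m (pullr m t) = t.
Proof.
move=> m0 t0 tm; have [t1|/ltW t1] := leP t 1; first by rewrite pullr_small ?pushr_small.
have d0 : 0 < 1 + m - t by rewrite subr_gt0.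
rewrite pullr_large // pushr_large; last by rewrite ler_pdivlMr // mul1r; lra.
by rewrite invf_div mulrC divfK ?gt_eqF //; ring.
Qed.

End RadialFunctions.

Section RadialMap.
Variables (R : realType) (n : nat).
Notation V := 'rV[R]_n.+1.
Implicit Type x : V.

(** On the ray through a point of the orthant, [radius], [depth] and [level]
    are homogeneous of degree 1 and [slope] is constant. The open simplex is
    the part of the orthant where radius < 1, that is level < 1 + slope. *)
Definition radius x : R := \sum_j x 0 j.
Definition depth x : R := \big[Num.min/radius x]_j x 0 j.
Definition orthant : set V := [set x | forall j, 0 < x 0 j].
Definition slope x : R := depth x / radius x.
Definition level x : R := radius x + depth x.

Lemma depth_gt0 x : 0 < depth x -> orthant x.
Proof. by move=> /bigmin_gtP[_ H] j; exact: H. Qed.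

Lemma orthant_radius x : orthant x -> 0 < radius x.
Proof. by move=> x0; rewrite /radius big_ord_recl ltr_pwDl // sumr_ge0 // => j _; exact: ltW. Qed.

Lemma orthant_depth x : orthant x -> 0 < depth x.
Proof. by move=> x0; apply/bigmin_gtP; split; [exact: orthant_radius | move=> j _; exact: x0]. Qed.

Lemma orthant_level x : orthant x -> 0 < level x.
Proof. by move=> x0; rewrite addr_gt0 ?orthant_radius ?orthant_depth. Qed.

Lemma orthant_slope x : orthant x -> 0 < slope x.
Proof. by move=> x0; rewrite divr_gt0 ?orthant_radius ?orthant_depth. Qed.

Lemma level_slope x : orthant x -> level x = radius x * (1 + slope x).
Proof.
move=> x0; rewrite mulrDr mulr1 /slope mulrC divfK // gt_eqF //.
exact: orthant_radius.
Qed.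

Lemma radiusZ (a : R) x : radius (a *: x) = a * radius x.
Proof. by rewrite /radius mulr_sumr; apply: eq_bigr => j _; rewrite mxE. Qed.

Lemma depthZ (a : R) x : 0 <= a -> depth (a *: x) = a * depth x.
Proof.
move=> a0; rewrite /depth radiusZ.
apply: (big_ind2 (fun u v => u = a * v)) => // [|j _].
  by move=> u u' v v' -> ->; rewrite minr_pMr.
by rewrite mxE.
Qed.

Lemma levelZ (a : R) x : 0 <= a -> level (a *: x) = a * level x.
Proof. by move=> a0; rewrite /level radiusZ depthZ // mulrDr. Qed.

Lemma slopeZ (a : R) x : 0 < a -> slope (a *: x) = slope x.
Proof.
move=> a0; rewrite /slope radiusZ depthZ ?ltW // invfM mulrACA divff ?mul1r //.
by rewrite gt_eqF.
Qed.

Lemma orthantZ (a : R) x : 0 < a -> orthant x -> orthant (a *: x).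
Proof. by move=> a0 x0 j; rewrite mxE mulr_gt0. Qed.

Lemma radius_continuous : continuous radius.
Proof. exact: sum_coord_continuous. Qed.

Lemma depth_continuous : continuous depth.
Proof.
rewrite /depth; elim: (index_enum _) => [|j s IH].
  have -> : (fun x : V => \big[Num.min/radius x]_(j <- [::]) x 0 j) = radius.
    by apply/funext => x; rewrite big_nil.
  exact: radius_continuous.
have -> : (fun x : V => \big[Num.min/radius x]_(i <- j :: s) x 0 i) =
    (fun x : V => Num.min (x 0 j) (\big[Num.min/radius x]_(i <- s) x 0 i)).
  by apply/funext => x; rewrite big_cons.
move=> x; apply: (@continuous_min _ _ (fun x : V => x 0 j)); last exact: IH.
exact: coord_continuous.
Qed.

Lemma level_continuous : continuous level.
Proof.
move=> x; apply: (@continuousD _ _ _ radius depth).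
  exact: radius_continuous.
exact: depth_continuous.
Qed.

Lemma slope_continuous x : orthant x -> {for x, continuous slope}.
Proof.
move=> x0; apply: (@continuousM _ _ depth (fun x => (radius x)^-1)).
  exact: depth_continuous.
apply: (@continuousV _ _ radius); last exact: radius_continuous.
by rewrite gt_eqF // orthant_radius.
Qed.

Lemma orthant_open : open orthant.
Proof.
rewrite openE => x x0.
have H : nbhs x [set y : V | forall j, 0 < y 0 j].
  apply: (filter_forall (nbhs_filter x)) => j.
  apply: (@coord_continuous R 1 n.+1 0 j x [set r | 0 < r]).
  by apply: open_nbhs_nbhs; split; [exact: open_gt | exact: x0].
exact: H.
Qed.

Lemma simplex_orthantP x : (simplex R n.+1)° x <-> orthant x /\ radius x < 1.
Proof.
split=> [/simplex_interiorP H|[x0 x1]].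
  split; first by move=> j; rewrite -bary_lift0.
  by have := H ord0; rewrite bary_ord0 subr_gt0.
apply/simplex_interiorP => i; case: (unliftP ord0 i) => [j|] ->.
  by rewrite bary_lift0.
by rewrite bary_ord0 subr_gt0.
Qed.

Lemma orthant_simplex x : orthant x -> radius x <= 1 -> simplex R n.+1 x.
Proof.
move=> x0 x1; apply/simplexP => i; case: (unliftP ord0 i) => [j|] ->.
  by rewrite bary_lift0 ltW.
by rewrite bary_ord0 subr_ge0.
Qed.

Lemma simplex_radius x : simplex R n.+1 x -> radius x <= 1.
Proof. by case. Qed.

(** [push] shrinks the orthant to the open simplex along rays and is the
    identity where level <= 1. Near a boundary point with radius < 1 the depth
    is small, so that level <= 1: [push] is the identity near every facet but
    the one where radius = 1. *)
Definition push x : V := (pushr (slope x) (level x) / level x) *: x.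
Definition pull x : V := (pullr (slope x) (level x) / level x) *: x.

Lemma push_factor x : orthant x -> 0 < pushr (slope x) (level x) / level x.
Proof.
move=> x0; rewrite divr_gt0 ?orthant_level //.
by have /andP[] := pushr_itv (orthant_slope x0) (orthant_level x0).
Qed.

Lemma radius_lt1 x : orthant x -> (radius x < 1) = (level x < 1 + slope x).
Proof.
move=> x0; rewrite level_slope // -{2}[1 + slope x]mul1r ltr_pM2r //.
by rewrite addr_gt0 ?orthant_slope.
Qed.

Lemma pull_factor x :
  orthant x -> radius x < 1 -> 0 < pullr (slope x) (level x) / level x.
Proof.
move=> x0; rewrite radius_lt1 // => x1.
by rewrite divr_gt0 ?pullr_gt0 ?orthant_level ?orthant_slope.
Qed.

Lemma push_interior x : orthant x -> (simplex R n.+1)° (push x).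
Proof.
move=> x0; have a0 := push_factor x0; have px0 := orthantZ a0 x0.
apply/simplex_orthantP; split=> //; rewrite radius_lt1 // slopeZ // levelZ ?ltW //.
rewrite divfK ?gt_eqF ?orthant_level //.
by have /andP[] := pushr_itv (orthant_slope x0) (orthant_level x0).
Qed.

Lemma pull_orthant x : orthant x -> radius x < 1 -> orthant (pull x).
Proof. by move=> x0 x1; apply: orthantZ => //; exact: pull_factor. Qed.

Lemma pushK x : orthant x -> pull (push x) = x.
Proof.
move=> x0; have a0 := push_factor x0; have l0 := orthant_level x0.
have /andP[p0 _] := pushr_itv (orthant_slope x0) l0.
rewrite /pull {1 2}/push slopeZ // levelZ ?ltW // divfK ?gt_eqF // pushrK ?orthant_slope //.
by rewrite /push scalerA mulrA divfK ?gt_eqF // divff ?scale1r // gt_eqF.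
Qed.

Lemma pullK x : orthant x -> radius x < 1 -> push (pull x) = x.
Proof.
move=> x0 x1; have a0 := pull_factor x0 x1; have l0 := orthant_level x0.
have xl : level x < 1 + slope x by rewrite -radius_lt1.
have p0 := pullr_gt0 (orthant_slope x0) l0 xl.
rewrite /push {1 2}/pull slopeZ // levelZ ?ltW // divfK ?gt_eqF // pullrK ?orthant_slope //.
by rewrite /pull scalerA mulrA divfK ?gt_eqF // divff ?scale1r // gt_eqF.
Qed.

Lemma push_id x : orthant x -> level x <= 1 -> push x = x.
Proof.
by move=> x0 x1; rewrite /push pushr_small // divff ?scale1r // gt_eqF ?orthant_level.
Qed.

Lemma pull_id x : orthant x -> level x <= 1 -> pull x = x.
Proof.
move=> x0 x1; rewrite /pull pullr_small ?orthant_slope //.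
by rewrite divff ?scale1r // gt_eqF ?orthant_level.
Qed.

Lemma push_continuous x : orthant x -> {for x, continuous push}.
Proof.
move=> x0; have l0 := orthant_level x0.
apply: continuousZ; last exact: cvg_id.
have lc := @level_continuous x; have sc := slope_continuous x0.
apply: (@continuousM _ _ (fun x => pushr (slope x) (level x)) (fun x => (level x)^-1)).
  apply: (@continuousD _ _ _ (fun x => Num.min (level x) 1)).
    by apply: (@continuous_min _ _ level (cst 1)) => //; exact: cst_continuous.
  apply: (@continuousM _ _ slope) => //.
  apply: (@continuousB _ _ _ (cst (1 : R))); first exact: cst_continuous.
  apply: (@continuousV _ _ (fun x => Num.max (level x) 1)).
    by rewrite gt_eqF // lt_max ltr01 orbT.
  by apply: (@continuous_max _ _ level (cst 1)) => //; exact: cst_continuous.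
by apply: (@continuousV _ _ level) => //; rewrite gt_eqF.
Qed.

Lemma pull_continuous x : orthant x -> radius x < 1 -> {for x, continuous pull}.
Proof.
move=> x0 x1; have l0 := orthant_level x0.
apply: continuousZ; last exact: cvg_id.
have lc := @level_continuous x; have sc := slope_continuous x0.
have s0 := orthant_slope x0.
apply: (@continuousM _ _ (fun x => pullr (slope x) (level x)) (fun x => (level x)^-1)).
  apply: (@continuousD _ _ _ (fun x => Num.min (level x) 1 - 1)).
    apply: (@continuousB _ _ _ (fun x => Num.min (level x) 1) (cst (1 : R)));
      last exact: cst_continuous.
    by apply: (@continuous_min _ _ level (cst 1)) => //; exact: cst_continuous.
  apply: (@continuousM _ _ slope) => //.
  apply: (@continuousV _ _ (fun x => 1 + slope x - Num.max (level x) 1)).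
    rewrite gt_eqF // subr_gt0 gt_max -radius_lt1 // x1 /=.
    by rewrite ltrDl.
  apply: (@continuousB _ _ _ (fun x => 1 + slope x)).
    by apply: (@continuousD _ _ _ (cst (1 : R))) => //; exact: cst_continuous.
  by apply: (@continuous_max _ _ level (cst 1)) => //; exact: cst_continuous.
by apply: (@continuousV _ _ level) => //; rewrite gt_eqF.
Qed.

(** The inversion on each ray exchanges the parts of the orthant where
    radius < 1 and radius > 1 and fixes the wall radius = 1 between them. *)
Definition invert x : V := ((radius x)^-1 ^+ 2) *: x.

Lemma invert_orthant x : orthant x -> orthant (invert x).
Proof. by move=> x0; apply: orthantZ => //; rewrite exprn_gt0 // invr_gt0 orthant_radius. Qed.

Lemma invert_radius x : orthant x -> radius (invert x) = (radius x)^-1.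
Proof.
move=> x0; rewrite radiusZ expr2 -mulrA mulVf ?mulr1 // gt_eqF //.
exact: orthant_radius.
Qed.

Lemma invertK x : orthant x -> invert (invert x) = x.
Proof.
move=> x0; rewrite {1}/invert invert_radius // /invert scalerA invrK -exprMn.
by rewrite mulfV ?expr1n ?scale1r // gt_eqF // orthant_radius.
Qed.

Lemma invert_id x : radius x = 1 -> invert x = x.
Proof. by move=> x1; rewrite /invert x1 invr1 expr1n scale1r. Qed.

Lemma invert_continuous x : orthant x -> {for x, continuous invert}.
Proof.
move=> x0; apply: continuousZ; last exact: cvg_id.
apply: (@continuousM _ _ (fun x => (radius x)^-1) (fun x => (radius x)^-1)).
all: apply: (@continuousV _ _ radius); last exact: radius_continuous.
all: by rewrite gt_eqF // orthant_radius.
Qed.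

End RadialMap.

(** * Gluing a simplex to a cell along a facet *)

Section Gluing.
Variables (R : realType) (n : nat) (M : topologicalType).
Notation V := 'rV[R]_n.+1.
Notation simplex := (simplex R n.+1).
Variables (P Q : V -> M) (C : set M).
Hypothesis hM : hausdorff_space M.
Hypothesis cP : {within simplex, continuous P}.
Hypothesis cQ : {within simplex, continuous Q}.
Hypothesis iP : {in simplex &, injective P}.
Hypothesis iQ : {in simplex &, injective Q}.
Hypothesis PQ : forall x, simplex x -> radius x = 1 -> P x = Q x.
Hypothesis CQ : forall x, simplex x -> ~ C (Q x).
Hypothesis PQ0 : forall x y, simplex x -> simplex° y -> P x <> Q y.
Hypothesis PC : forall x, simplex° x -> C (P x).
Hypothesis oP : open (P @` simplex°).

(** Two simplexes P and Q agree on the facet radius = 1, and P lies in C. The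
    open set D, made of both open simplexes and of the open facet between them,
    is parametrised by the orthant through the map J below: P where
    radius <= 1 and the inverted Q where radius >= 1. Transporting [push]
    through J carries D onto the open simplex of P; extended by the identity
    this gives the homeomorphism with C, since [push] moves no point close to
    the rest of C. *)
Let wall : set V := [set x | orthant x /\ radius x = 1].
Let D := P @` simplex° `|` P @` wall `|` Q @` simplex°.
Hypothesis oD : open D.

Let J (x : V) := if radius x <= 1 then P x else Q (invert x).

Let J_small x : radius x <= 1 -> J x = P x.
Proof. by rewrite /J => ->. Qed.

Let wall_simplex x : orthant x -> radius x = 1 -> simplex x.
Proof. by move=> x0 x1; apply: orthant_simplex; rewrite ?x1. Qed.

Let invert_simplex x : orthant x -> 1 <= radius x -> simplex (invert x).
Proof.
move=> x0 x1; apply: orthant_simplex; first exact: invert_orthant.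
by rewrite invert_radius // invf_le1 // orthant_radius.
Qed.

Let J_large x : orthant x -> 1 <= radius x -> J x = Q (invert x).
Proof.
move=> x0 x1; rewrite /J; case: ifP => // x1'.
have {x1'}x1 : radius x = 1 by apply/eqP; rewrite eq_le x1 x1'.
by rewrite invert_id // PQ //; exact: wall_simplex.
Qed.

Let JD x : orthant x -> D (J x).
Proof.
move=> x0; have [x1|x1] := leP (radius x) 1.
  rewrite J_small //; left; move: x1; rewrite le_eqVlt => /orP[/eqP x1|x1].
    by right; exists x.
  by left; exists x => //; apply/simplex_orthantP.
rewrite J_large // ?ltW //; right; exists (invert x) => //.
apply/simplex_orthantP; split; first exact: invert_orthant.
by rewrite invert_radius // invf_lt1 // orthant_radius.
Qed.

Let DJ q : D q -> exists2 x, orthant x & J x = q.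
Proof.
case=> [[[x /simplex_orthantP[x0 x1] <-]|[x [x0 x1] <-]]|[x /simplex_orthantP[x0 x1] <-]].
- by exists x => //; rewrite J_small // ltW.
- by exists x => //; rewrite J_small // x1.
exists (invert x); first exact: invert_orthant.
rewrite J_large ?invertK //; first exact: invert_orthant.
by rewrite invert_radius // invf_ge1 ?ltW // orthant_radius.
Qed.

Let J_inj x y : orthant x -> orthant y -> J x = J y -> x = y.
Proof.
have mixed u v : orthant u -> orthant v -> radius u <= 1 -> 1 < radius v -> J u <> J v.
  move=> u0 v0 u1 v1; rewrite J_small // J_large ?(ltW v1) // => E.
  have sv := invert_simplex v0 (ltW v1).
  move: u1; rewrite le_eqVlt => /orP[/eqP u1|u1].
    have su := wall_simplex u0 u1.
    move: E; rewrite PQ // => /(iQ (mem_set su) (mem_set sv)) E.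
    move: v1; rewrite -(invertK v0) -E invert_radius // u1 invr1.
    by rewrite ltxx.
  by apply: (CQ sv); rewrite -E; apply: PC; apply/simplex_orthantP.
move=> x0 y0 E; have [x1|x1] := leP (radius x) 1; have [y1|y1] := leP (radius y) 1.
- move: E; rewrite !J_small // => /iP; apply; apply: mem_set; exact: orthant_simplex.
- by case: (mixed _ _ x0 y0 x1 y1).
- by case: (mixed _ _ y0 x0 y1 x1).
- move: E; rewrite !J_large ?ltW // => /iQ E.
  by rewrite -(invertK x0) E ?invertK //; apply: mem_set; apply: invert_simplex; rewrite ?ltW.
Qed.

Let closedP (A : set V) : closed A -> A `<=` simplex -> closed (P @` A).
Proof.
move=> clA As; apply: compact_closed => //; apply: continuous_compact.
  exact: continuous_subspaceW cP.
by apply: subclosed_compact As => //; exact: simplex_compact.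
Qed.

Let closedQ : closed (Q @` simplex).
Proof. by apply: compact_closed => //; apply: continuous_compact => //; exact: simplex_compact. Qed.

(** J is open because P and Q are homeomorphisms onto closed sets. *)
Let J_open x U : orthant x -> nbhs x U ->
  \forall q \near J x, D q -> exists y, [/\ orthant y, U y & J y = q].
Proof.
move=> x0 xU.
have nP : \forall q \near J x, forall z, simplex z -> P z = q -> U z.
  have [x1|x1] := leP (radius x) 1.
    rewrite J_small //; have sx := orthant_simplex x0 x1.
    have := compact_inverse_nbhs hM (@simplex_compact R n.+1) cP iP sx xU.
    by apply: filterS => q H z sz zq; exact: H.
  have sx : simplex° (invert x).
    apply/simplex_orthantP; split; first exact: invert_orthant.
    by rewrite invert_radius // invf_lt1 // orthant_radius.
  have nPx : (~` (P @` simplex)) (J x).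
    by rewrite J_large ?(ltW x1) // => -[z sz]; exact: PQ0.
  have oPc : open (~` (P @` simplex))
    by apply: closed_openC; exact: closedP (@simplex_closed R _) _.
  apply: filterS (open_nbhs_nbhs (conj oPc nPx)) => q nq z sz zq.
  by case: nq; exists z.
have nQ : \forall q \near J x, forall z, simplex z -> Q z = q -> U (invert z).
  have [x1|x1] := ltP (radius x) 1.
    have nQx : (~` (Q @` simplex)) (J x).
      rewrite J_small ?ltW // => -[z sz zq]; apply: (CQ sz); rewrite zq.
      by apply: PC; apply/simplex_orthantP.
    apply: filterS (open_nbhs_nbhs (conj (closed_openC closedQ) nQx)) => q nq z sz zq.
    by case: nq; exists z.
  have ix0 := invert_orthant x0; have sx := invert_simplex x0 x1.
  rewrite J_large //; apply: compact_inverse_nbhs => //; first exact: simplex_compact.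
  by have := invert_continuous ix0; apply; rewrite invertK.
apply: filterS2 nP nQ => q HP HQ /DJ[y y0 Jy]; exists y; split=> //.
have [y1|y1] := leP (radius y) 1.
  by apply: HP; [exact: orthant_simplex | rewrite -J_small].
rewrite -(invertK y0); apply: HQ; first by apply: invert_simplex; rewrite ?ltW.
by rewrite -J_large ?ltW.
Qed.

Let J_continuous x N : orthant x -> nbhs (J x) N ->
  \forall y \near x, orthant y -> N (J y).
Proof.
move=> x0 xN.
have nP : \forall y \near x, simplex y -> N (P y).
  have [x1|x1] := leP (radius x) 1.
    by apply: within_nbhs => //; [exact: orthant_simplex | rewrite -J_small].
  have o : nbhs x [set y : V | 1 < radius y].
    apply: (@radius_continuous R n x [set r | 1 < r]).
    by apply: open_nbhs_nbhs; split; [exact: open_gt|].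
  by apply: filterS o => y /= y1 /simplex_radius; rewrite leNgt y1.
have nQ : \forall y \near x, simplex (invert y) -> N (Q (invert y)).
  have [x1|x1] := ltP (radius x) 1.
    have o : nbhs x [set y : V | orthant y /\ radius y < 1].
      apply: open_nbhs_nbhs; split; last by [].
      apply: openI; first exact: orthant_open.
      by apply: (@open_comp _ _ (@radius R n) [set r | r < 1]) => [y _|];
        [exact: radius_continuous | exact: open_lt].
    apply: filterS o => y /= [y0 y1] /simplex_radius; rewrite invert_radius //.
    by rewrite invf_le1 ?orthant_radius // leNgt y1.
  have H : \forall z \near invert x, simplex z -> N (Q z).
    by apply: within_nbhs => //; [exact: invert_simplex | rewrite -J_large].
  exact: (invert_continuous x0 H).
apply: filterS2 nP nQ => y HP HQ y0.
have [y1|y1] := leP (radius y) 1.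
  by rewrite J_small //; apply: HP; exact: orthant_simplex.
by rewrite J_large ?ltW //; apply: HQ; apply: invert_simplex; rewrite ?ltW.
Qed.

Let rim : set V := [set x | simplex x /\ 1 <= level x].

(** The homeomorphism is going to be the identity on this open set, which
    contains all of C outside the open simplex of P. *)
Let far : set M := ~` (Q @` simplex `|` P @` rim).

Let far_open : open far.
Proof.
apply: closed_openC; apply: closedU closedQ _; apply: closedP; last by move=> x [].
apply: closedI; first exact: simplex_closed.
apply: (@preimage_closed _ _ (@level R n) [set r | 1 <= r]).
  by move=> x _; exact: level_continuous.
exact: closed_ge.
Qed.

Let far_small q x : far q -> orthant x -> J x = q -> radius x < 1 /\ level x <= 1.
Proof.
move=> fq x0 Jx.
have x1 : radius x < 1.
  rewrite ltNge; apply/negP => x1; apply: fq; left.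
  by exists (invert x); [exact: invert_simplex | rewrite -J_large].
split=> //; rewrite leNgt; apply/negP => lx; apply: fq; right.
exists x; last by rewrite -J_small // ltW.
by split; [apply: orthant_simplex; rewrite ?ltW | exact: ltW].
Qed.

Let C_far q : C q -> ~ (P @` simplex°) q -> far q.
Proof.
move=> Cq nq [[x sx xq]|[x [sx lx] xq]]; first by apply: (CQ sx); rewrite xq.
have [x1|x1] := ltP (radius x) 1.
  apply: nq; exists x => //; apply/simplex_orthantP; split=> //.
  by apply: depth_gt0; move: lx x1; rewrite /level; lra.
apply: (CQ sx); rewrite -PQ ?xq //; apply/eqP; rewrite eq_le x1.
by rewrite simplex_radius.
Qed.

Let DC q : D q -> C q -> (P @` simplex°) q.
Proof.
move=> [[//|[x [x0 x1] <-]]|[x sx <-]] Cq.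
  by exfalso; move: Cq; rewrite PQ //; [apply: CQ|]; apply: wall_simplex.
by case: (CQ (interior_subset sx) Cq).
Qed.

Lemma glue_simplex : homeomorphic (C `|` P @` wall `|` Q @` simplex°) C.
Proof.
have sub q : (C `|` P @` wall `|` Q @` simplex°) q -> D q \/ far q.
  case=> [[Cq|wq]|sq]; last by left; right.
    have [Pq|Pq] := pselect ((P @` simplex°) q); first by left; left; left.
    by right; exact: C_far.
  by left; left; right.
have supD q : D q -> (C `|` P @` wall `|` Q @` simplex°) q.
  case=> [[[x sx <-]|wq]|sq]; [left; left; exact: PC | by left; right | by right].
have supC q : C q -> (C `|` P @` wall `|` Q @` simplex°) q by move=> ?; left; left.
have /choice[G GP] : forall q, exists x, D q -> orthant x /\ J x = q.
  move=> q; have [/DJ[x x0 xq]|nq] := pselect (D q); first by exists x.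
  by exists 0.
have GJ x : orthant x -> G (J x) = x.
  by move=> x0; have [g0 gx] := GP _ (JD x0); exact: J_inj.
pose h q := if pselect (D q) then P (push (G q)) else q.
pose h' q := if pselect ((P @` simplex°) q) then J (pull (G q)) else q.
have hD q : D q -> h q = P (push (G q)) by rewrite /h; case: pselect.
have hJ x : orthant x -> h (J x) = P (push x).
  by move=> x0; rewrite hD ?GJ //; exact: JD.
have hN q : ~ D q -> h q = q by rewrite /h; case: pselect.
have h'E q : (P @` simplex°) q -> h' q = J (pull (G q)).
  by rewrite /h'; case: pselect.
have h'P x : simplex° x -> h' (P x) = J (pull x).
  move=> sx; rewrite h'E; last by exists x.
  by have /simplex_orthantP[x0 x1] := sx; rewrite -{1}(J_small (ltW x1)) GJ.
have h'N q : ~ (P @` simplex°) q -> h' q = q by rewrite /h'; case: pselect.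
have h_far q : far q -> h q = q.
  move=> fq; have [Dq|/hN//] := pselect (D q); have [x x0 xq] := DJ Dq.
  have [x1 lx] := far_small fq x0 xq.
  by rewrite -xq hJ // push_id // J_small // ltW.
have h'_far q : far q -> h' q = q.
  move=> fq; have [[x sx xq]|/h'N//] := pselect ((P @` simplex°) q).
  have /simplex_orthantP[x0 x1] := sx.
  have [|_ lx] := far_small fq x0; first by rewrite J_small // ltW.
  by rewrite -xq h'P // pull_id // J_small // ltW.
apply: (homeomorphic_of (f := h) (g := h')).
- move=> q Cq; have [/DJ[x x0 <-]|nq] := pselect (D q).
    by rewrite hJ //; apply: PC; exact: push_interior.
  rewrite hN //; case: Cq => [[//|wq]|sq]; exfalso; apply: nq; last by right.
  by left; right.
- move=> q Cq; have [[x sx <-]|nq] := pselect ((P @` simplex°) q).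
    have /simplex_orthantP[x0 x1] := sx; rewrite h'P //.
    by apply/supD/JD; exact: pull_orthant.
  by rewrite h'N //; exact: supC.
- move=> q Cq; have [/DJ[x x0 <-]|nq] := pselect (D q).
    rewrite hJ // h'P; last exact: push_interior.
    by rewrite pushK.
  by rewrite hN // h'N // => Pq; apply: nq; left; left.
- move=> q Cq; have [[x sx <-]|nq] := pselect ((P @` simplex°) q).
    have /simplex_orthantP[x0 x1] := sx.
    by rewrite h'P // hJ ?pullK //; exact: pull_orthant.
  by rewrite h'N // hN // => Dq; apply: nq; exact: DC.
- move=> q Cq N; have [Dq|nDq] := pselect (D q); last first.
    have [//|fq] := sub _ Cq; rewrite h_far // => qN.
    apply: filterS2 qN (open_nbhs_nbhs (conj far_open fq)) => q' Nq' fq' _.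
    by rewrite h_far.
  have [x x0 xq] := DJ Dq; rewrite -xq hJ // => xN.
  have xU : nbhs x [set y | N (P (push y))].
    have sp := push_interior x0.
    have : nbhs (push x) [set z | N (P z)].
      have H := within_nbhs cP (interior_subset sp) xN.
      apply: filterS2 H (open_nbhs_nbhs (conj (@simplex_interior_open R n.+1) sp)) => z Nz sz.
      by apply: Nz; exact: interior_subset.
    exact: push_continuous.
  have nD : nbhs (J x) D by apply: open_nbhs_nbhs; rewrite xq.
  apply: filterS2 nD (J_open x0 xU) => q' Dq' /(_ Dq')[y [y0 Ny <-]] _.
  by rewrite hJ.
- move=> q Cq N; have [[x sx xq]|nq] := pselect ((P @` simplex°) q); last first.
    have fq := C_far Cq nq; rewrite h'_far // => qN.
    apply: filterS2 qN (open_nbhs_nbhs (conj far_open fq)) => q' Nq' fq' _.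
    by rewrite h'_far.
  have /simplex_orthantP[x0 x1] := sx; rewrite -xq h'P // => xN.
  have px0 := pull_orthant x0 x1.
  have xU : nbhs x [set y | N (J (pull y))].
    have : nbhs (pull x) [set z | N (J z)].
      apply: filterS2 (J_continuous px0 xN) (open_nbhs_nbhs (conj (@orthant_open R n) px0)).
      by move=> z Nz z0; exact: Nz.
    exact: pull_continuous.
  have nP : nbhs (P x) (P @` simplex°) by apply: open_nbhs_nbhs; split => //; exists x.
  have := J_open x0 xU; rewrite J_small ?ltW //.
  apply: filterS2 nP => _ [y sy <-] H _; have /simplex_orthantP[y0 y1] := sy.
  have [|z [z0 Nz E]] := H; first by left; left; exists y.
  have zy : z = y by apply: J_inj => //; rewrite E J_small // ltW.
  by rewrite h'P // -zy.
Qed.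

End Gluing.

(** * Connectedness along segments *)

Lemma open_preimage_on (X Y : topologicalType) (W : set X) (f : X -> Y) (O : set Y) :
  open W -> {in W, continuous f} -> open O -> open (W `&` f @^-1` O).
Proof.
move=> oW cf oO; rewrite openE => x [Wx Ox]; apply: filterI.
  exact: open_nbhs_nbhs.
by apply: (cf x (mem_set Wx)); exact: open_nbhs_nbhs.
Qed.

Lemma segment_closed_meet (R : realType) (Y : topologicalType) (f : R -> Y)
    (U V : set Y) :
  (forall t, 0 <= t <= 1 -> {for t, continuous f}) ->
  closed U -> closed V -> U (f 0) -> V (f 1) ->
  (forall t, 0 <= t <= 1 -> U (f t) \/ V (f t)) ->
  exists2 t, 0 <= t <= 1 & U (f t) /\ V (f t).
Proof.
move=> cf cU cV U0 V1 UV; apply: contrapT => nUV.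
have nUV' t : 0 <= t <= 1 -> U (f t) -> V (f t) -> False.
  by move=> t01 Ut Vt; apply: nUV; exists t.
have cI : closed (`[0, 1]%classic : set R) by exact: interval_closed.
have clI (A : set Y) : closed A -> closed (`[0, 1]%classic `&` f @^-1` A).
  move=> cA t ct; have t01 : 0 <= t <= 1.
    have : closure (`[0, 1]%classic : set R) t by apply: closure_subset ct => s [].
    by move/cI.
  split=> //; apply: cA => N ftN.
  have [s [[sI As] Ns]] := ct _ (cf _ t01 _ ftN).
  by exists (f s).
have : `[0, 1]%classic `&` f @^-1` U = `[0, 1]%classic.
  apply: (@segment_connected R 0 1).
  - by exists 0; split => //=; rewrite in_itv /= lexx ler01.
  - exists (~` (`[0, 1]%classic `&` f @^-1` V)); first by apply: closed_openC; exact: clI.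
    apply/seteqP; split=> t [t01 Ut]; split=> //.
      by move=> [_ Vt]; apply: (nUV' t) => //; rewrite -in_itv.
    have t01' : 0 <= t <= 1 by move: t01; rewrite /= in_itv.
    by case: (UV t t01') => // Vt; case: Ut.
  - by exists (`[0, 1]%classic `&` f @^-1` U); [exact: clI | rewrite setIA setIid].
move/seteqP => [_ /(_ 1)]; rewrite /= in_itv /= lexx ler01 => /(_ isT)[_ U1].
by apply: (nUV' 1) => //; rewrite lexx ler01.
Qed.

Lemma segment_open_meet (R : realType) (Y : topologicalType) (f : R -> Y)
    (U V : set Y) :
  (forall t, 0 <= t <= 1 -> {for t, continuous f}) ->
  open U -> open V -> U (f 0) -> V (f 1) ->
  (forall t, 0 <= t <= 1 -> U (f t) \/ V (f t)) ->
  exists2 t, 0 <= t <= 1 & U (f t) /\ V (f t).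
Proof.
move=> cf oU oV U0 V1 UV; apply: contrapT => nUV.
have nUV' t : 0 <= t <= 1 -> U (f t) -> V (f t) -> False.
  by move=> t01 Ut Vt; apply: nUV; exists t.
have [|||t t01 [nV nU]] := segment_closed_meet cf (open_closedC oV) (open_closedC oU).
- by move=> V0; apply: (nUV' 0) => //; rewrite lexx ler01.
- by move=> U1; apply: (nUV' 1) => //; rewrite lexx ler01.
- by move=> t t01; case: (UV t t01) => H; [left|right] => H'; exact: (nUV' t).
- by case: (UV t t01).
Qed.

(** * Strata of a triangulation *)

Section Triangulation.
Variables (R : realType) (n : nat) (M : topologicalType).
Variable X : smooth_manifold R n M.
Variable T : smooth_triangulation X.
Notation tri := (@tri R n M X T).

(** The witnesses of smoothness of a simplex, which are used to compute with
    maps defined on the whole of R^l. *)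
Definition extends l (phi : simplex R l -> M) (W : set 'rV[R]_l) psi :=
  [/\ open W, simplex R l `<=` W, diffeo_onto_image X W psi &
      forall x : simplex R l, phi x = psi (val x)].

Lemma tri_extends l (phi : simplex R l -> M) :
  tri phi -> exists W psi, extends phi W psi.
Proof. exact: tri_smooth. Qed.

Section Extension.
Variables (l : nat) (phi : simplex R l -> M) (W : set 'rV[R]_l) (psi : 'rV[R]_l -> M).
Hypothesis E : extends phi W psi.

Lemma extends_val x (sx : simplex R l x) :
  phi (exist (fun y => y \in simplex R l) x (mem_set sx)) = psi x.
Proof. by have [_ _ _ ->] := E. Qed.

Lemma extends_range : range phi = psi @` simplex R l.
Proof.
have [_ _ _ phiE] := E; apply/seteqP; split=> q [x].
  by move=> _ <-; exists (val x); [exact: set_valP | rewrite phiE].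
by move=> sx <-; eexists => //; exact: extends_val.
Qed.

Lemma extends_open : open_simplex phi = psi @` (simplex R l)°.
Proof.
have [_ _ _ phiE] := E; apply/seteqP; split=> q [x].
  by move=> /= sx <-; exists (val x); rewrite ?phiE.
move=> sx <-; exists (exist (fun y => y \in simplex R l) x
  (mem_set (interior_subset sx))) => //.
Qed.

Lemma extends_inj : {in W &, injective psi}.
Proof.
have [_ _ [_ [g [gK _]]] _] := E; move=> x y Wx Wy xy.
by rewrite -(gK x Wx) -(gK y Wy) xy.
Qed.

Lemma extends_inj_simplex : {in simplex R l &, injective psi}.
Proof.
have [_ sW _ _] := E; move=> x y sx sy; apply: extends_inj;
  by apply: mem_set; apply: sW; exact: set_mem.
Qed.

Lemma extends_continuous : {in W, continuous psi}.
Proof. by have [_ _ [[]]] := E. Qed.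

Lemma extends_within : {within simplex R l, continuous psi}.
Proof.
apply: continuous_in_subspaceT => x /set_mem sx; apply: extends_continuous.
by apply: mem_set; have [_ sW _ _] := E; exact: sW.
Qed.

Lemma extends_dense q N : range phi q -> nbhs q N ->
  exists2 q', open_simplex phi q' & N q'.
Proof.
rewrite extends_range extends_open => -[x sx <-] xN.
have [_ sW _ _] := E.
have [y Ny sy] := simplex_interior_dense sx (extends_continuous (mem_set (sW _ sx)) xN).
by exists (psi y) => //; exists y.
Qed.

End Extension.

Lemma open_simplex_range l (phi : simplex R l -> M) q :
  open_simplex phi q -> range phi q.
Proof. by move=> [x _ <-]; exists x. Qed.

Lemma tri_range_closed l (phi : simplex R l -> M) : tri phi -> closed (range phi).
Proof.
move=> /tri_extends[W [psi E]]; rewrite (extends_range E).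
apply: compact_closed; first exact: manifold_hausdorff X.
by apply: continuous_compact; [exact: extends_within E | exact: simplex_compact].
Qed.

Lemma tri_le l (phi : simplex R l -> M) : tri phi -> (l <= n)%N.
Proof. by move=> t; rewrite leqNgt; apply/negP => /(tri_dim T) E; rewrite E in t. Qed.

Lemma tri_pair l l' (phi : simplex R l -> M) (phi' : simplex R l' -> M) q :
  tri phi -> tri phi' -> open_simplex phi q -> open_simplex phi' q ->
  existT (fun l => simplex R l -> M) l phi = existT _ l' phi'.
Proof.
move=> t t' o o'.
by have := @tri_disjoint _ _ _ _ T (existT _ l phi) (existT _ l' phi') t t'; apply; exists q.
Qed.

Lemma tri_eq_dim l l' (phi : simplex R l -> M) (phi' : simplex R l' -> M) q :
  tri phi -> tri phi' -> open_simplex phi q -> open_simplex phi' q -> l = l'.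
Proof. by move=> t t' o o'; have /eqP := tri_pair t t' o o'; move=> /eqP[]. Qed.

Lemma tri_eq l (phi phi' : simplex R l -> M) q :
  tri phi -> tri phi' -> open_simplex phi q -> open_simplex phi' q -> phi = phi'.
Proof.
move=> t t' o o'; have := tri_pair t t' o o'.
by apply: inj_pair2_eq_dec; exact: PeanoNat.Nat.eq_dec.
Qed.

Lemma tri_point q : exists l (phi : simplex R l -> M), tri phi /\ open_simplex phi q.
Proof.
have : [set: M] q by []; rewrite -(tri_cover T) => -[l _ [phi t o]].
by exists l, phi.
Qed.

Lemma face_simplex l (phi : simplex R l.+1 -> M) W psi i
    (z : simplex R l) : extends phi W psi ->
  (phi \o face i) z = psi (face_map i (val z)).
Proof. by move=> [_ _ _ phiE]; rewrite /= phiE. Qed.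

Lemma facet_range l (phi : simplex R l.+1 -> M) i q :
  range (phi \o @face R l i) q -> range phi q.
Proof. by move=> [x _ <-]; exists (face i x). Qed.

Lemma not_interior l (x : 'rV[R]_l) :
  simplex R l x -> ~ (simplex R l)° x -> exists i, barycentric x i = 0.
Proof.
move=> /simplexP s0 nx; apply: contrapT => nE; apply: nx.
apply/simplex_interiorP => i; rewrite lt_neqAle s0 andbT; apply/eqP => E0.
by apply: nE; exists i.
Qed.

Lemma boundary_facet l (phi : simplex R l.+1 -> M) q :
  tri phi -> range phi q -> ~ open_simplex phi q ->
  exists i, range (phi \o @face R l i) q.
Proof.
move=> /tri_extends[W [psi E]]; rewrite (extends_range E) (extends_open E).
move=> [x sx <-] nx.
have [i x0] : exists i, barycentric x i = 0.
  by apply: not_interior => // sx'; apply: nx; exists x.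
have [z [sz zx _]] := face_map_surj sx x0.
exists i, (exist (fun y => y \in simplex R l) z (mem_set sz)) => //.
by rewrite (face_simplex _ _ E) /= zx.
Qed.

(** The axiom on faces, applied repeatedly: a closed simplex is its open
    simplex together with open simplexes of smaller dimensions. As the open
    simplexes are disjoint, this makes dimension arguments possible. *)
Lemma range_stratum l (phi : simplex R l -> M) q : tri phi -> range phi q ->
  open_simplex phi q \/ exists l' (phi' : simplex R l' -> M),
    [/\ (l' < l)%N, tri phi' & open_simplex phi' q].
Proof.
elim: l phi => [|l IH] phi t r.
  left; have [W [psi E]] := tri_extends t.
  move: r; rewrite (extends_range E) (extends_open E) => -[x _ <-]; exists x => //.
  by apply/simplex_interiorP => i; rewrite (ord1 i) bary_ord0 big_ord0 subr0.
have [|no] := pselect (open_simplex phi q); first by left.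
have [i ri] := boundary_facet t r no; right.
have ti := tri_face i t.
have [op|[l' [phi' [l'l t' o']]]] := IH _ ti ri; first by exists l, (phi \o @face R l i).
by exists l', phi'; split => //; exact: leq_trans l'l _.
Qed.

Lemma range_dim l l' (phi : simplex R l -> M) (phi' : simplex R l' -> M) q :
  tri phi -> tri phi' -> range phi q -> open_simplex phi' q -> (l' <= l)%N.
Proof.
move=> t t' r o'; have [op|[k [phi'' [kl t'' o'']]]] := range_stratum t r.
  by rewrite (tri_eq_dim t t' op o').
by rewrite -(tri_eq_dim t'' t' o'' o') ltnW.
Qed.

Lemma range_open_eq l (phi phi' : simplex R l -> M) q :
  tri phi -> tri phi' -> range phi q -> open_simplex phi' q -> phi = phi'.
Proof.
move=> t t' r o'; have [op|[k [phi'' [kl t'' o'']]]] := range_stratum t r.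
  exact: tri_eq t t' op o'.
by move: kl; rewrite (tri_eq_dim t'' t' o'' o') ltnn.
Qed.

Lemma range_facet_eq l (phi : simplex R l.+1 -> M) (sigma : simplex R l -> M) q :
  tri phi -> tri sigma -> range phi q -> open_simplex sigma q ->
  exists i, phi \o @face R l i = sigma.
Proof.
move=> t ts r o.
have [i ri] : exists i, range (phi \o @face R l i) q.
  apply: boundary_facet => // o'; have := tri_eq_dim t ts o' o.
  by move/eqP; rewrite eqn_leq ltnn.
by exists i; apply: range_open_eq ri o => //; exact: tri_face.
Qed.

(** A point of codimension at least 2 has two vanishing barycentric
    coordinates. *)
Lemma two_facets l (phi : simplex R l.+1 -> M) q :
  tri phi -> range phi q -> ~ open_simplex phi q ->
  (forall i, ~ open_simplex (phi \o @face R l i) q) ->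
  exists i j, [/\ i != j, range (phi \o @face R l i) q &
                  range (phi \o @face R l j) q].
Proof.
move=> t r no nof; have [i ri] := boundary_facet t r no.
have [W [psi E]] := tri_extends t.
have := ri; move=> [z _]; rewrite (face_simplex _ _ E) => zq.
have sz := set_valP z; have sx := face_map_simplex i sz.
have [k zk] : exists k, barycentric (val z) k = 0.
  apply: not_interior => // oz; apply: (nof i); exists z => //.
  by rewrite (face_simplex _ _ E).
have xk : barycentric (face_map i (val z)) (lift i k) = 0 by rewrite bary_face_lift.
have [y [sy yx _]] := face_map_surj sx xk.
exists i, (lift i k); split=> //; first exact: neq_lift.
exists (exist (fun y => y \in simplex R l) y (mem_set sy)) => //.
by rewrite (face_simplex _ _ E) /= yx.
Qed.

Lemma facet_inj l (phi : simplex R l.+1 -> M) i j : tri phi ->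
  phi \o @face R l i = phi \o @face R l j -> i = j.
Proof.
move=> t ij; have [W [psi E]] := tri_extends t.
have sc := interior_subset (@center_interior R l).
have := congr1 (fun f => f (exist (fun y => y \in simplex R l) _ (mem_set sc))) ij.
rewrite !(face_simplex _ _ E) /= => /(extends_inj_simplex E) H.
have {}H := H (mem_set (face_map_simplex i sc)) (mem_set (face_map_simplex j sc)).
case: (unliftP j i) => [k|//] ik.
have := bary_face_self i (center R l); rewrite H ik bary_face_lift bary_center => /eqP.
by rewrite invr_eq0 pnatr_eq0.
Qed.

(** The complement of such a set is the union of the finitely many closed
    simplexes that miss it. In this way open n-simplexes and open stars are seen
    to be open without looking at charts. *)
Lemma open_star (O : set M) :
  (forall l (tau : simplex R l -> M) q, tri tau -> range tau q -> O q ->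
     open_simplex tau `<=` O) -> open O.
Proof.
move=> H; rewrite -(setCK O); apply: closed_openC.
have -> : ~` O = \bigcup_(l in `I_n.+1)
    \bigcup_(tau in [set tau | @Defs.tri R n M X T l tau /\ range tau `&` O = set0]) range tau.
  apply/seteqP; split=> q.
    move=> nq; have [l [tau [t o]]] := tri_point q.
    exists l; first by rewrite /= ltnS; exact: tri_le t.
    exists tau; last exact: open_simplex_range.
    split=> //; apply/seteqP; split=> // q' [rq' Oq'].
    by apply: nq; exact: (H _ _ _ t rq' Oq').
  move=> [l _ [tau [t tO] r]] Oq.
  by have : (range tau `&` O) q by []; rewrite tO.
apply: closed_bigcup => [|l _]; first exact: finite_II.
apply: closed_bigcup => [|tau [t _]]; last exact: tri_range_closed.
by apply: sub_finite_set (tri_finite T l) => tau [].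
Qed.

Lemma tri_top_open (phi : simplex R n -> M) : tri phi -> open (open_simplex phi).
Proof.
move=> t; apply: open_star => l tau q tt r o.
have ln := tri_le tt; have nl := range_dim tt t r o.
have {ln nl}E : l = n by apply/eqP; rewrite eqn_leq ln.
by subst l; rewrite (range_open_eq tt t r o).
Qed.

End Triangulation.

(** * Charts and simplexes of maximal dimension *)

Section Charts.
Variables (R : realType) (n : nat) (M : topologicalType).

Lemma chart_inj (c : chart R n M) : {in chart_dom c &, injective c}.
Proof.
by move=> p q pd qd pq; rewrite -(chart_mapK pd) -(chart_mapK qd) pq.
Qed.

Lemma chart_continuous (c : chart R n M) : {in chart_dom c, continuous c}.
Proof.
have := @chart_map_continuous _ _ _ c; rewrite continuous_open_subspace //.
exact: chart_dom_open.
Qed.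

Lemma chart_inv_at (c : chart R n M) : {in c @` chart_dom c, continuous (chart_inv c)}.
Proof.
have := @chart_inv_continuous _ _ _ c; rewrite continuous_open_subspace //.
exact: chart_img_open.
Qed.

Lemma chart_invK (c : chart R n M) y : (c @` chart_dom c) y ->
  c (chart_inv c y) = y /\ chart_dom c (chart_inv c y).
Proof. by move=> [p pd <-]; rewrite (chart_mapK (mem_set pd)). Qed.

Lemma chart_image_open (c : chart R n M) (O : set M) :
  open O -> open (c @` (O `&` chart_dom c)).
Proof.
move=> oO; have -> : c @` (O `&` chart_dom c) =
    (c @` chart_dom c) `&` chart_inv c @^-1` O.
  apply/seteqP; split=> y.
    by move=> [p [Op pd] <-]; split; [exists p | rewrite /= (chart_mapK (mem_set pd))].
  move=> [yd /= Oy]; have [ye yd'] := chart_invK yd.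
  by exists (chart_inv c y).
by apply: open_preimage_on => //; [exact: chart_img_open | exact: chart_inv_at].
Qed.

Lemma chart_ball (c : chart R n M) (p : M) (O : set M) :
  chart_dom c p -> nbhs p O ->
  exists2 r : R, 0 < r & forall y, `|y - c p| < r ->
    (c @` chart_dom c) y /\ O (chart_inv c y).
Proof.
move=> pd; rewrite nbhsE => -[V [oV Vp] VO].
have : nbhs (c p) (c @` (V `&` chart_dom c)).
  by apply: open_nbhs_nbhs; split; [exact: chart_image_open | exists p].
move=> /nbhs_ballP[r /= r0 H]; exists r => // y yr.
have [|q [Vq qd] <-] := H y; first by rewrite -ball_normE /= distrC.
by split; [exists q | rewrite (chart_mapK (mem_set qd)); exact: VO].
Qed.

Lemma atlas_chart (X : smooth_manifold R n M) p :
  exists2 c, atlas X c & chart_dom c p.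
Proof. by have : [set: M] p by []; rewrite -(atlas_cover X) => -[c ac cp]; exists c. Qed.

Variable X : smooth_manifold R n M.

(** Invariance of domain, in the smooth case: the smooth left inverse makes
    the derivative injective, hence invertible as the dimensions agree, and
    the inverse function theorem applies. *)
Lemma diffeo_open_map (W U : set 'rV[R]_n) (psi : 'rV[R]_n -> M) x :
  open W -> diffeo_onto_image X W psi -> W x -> nbhs x U ->
  nbhs (psi x) (psi @` (W `&` U)).
Proof.
move=> oW [[cpsi spsi] [g [gK sg]]] Wx xU.
have [c ac px] := atlas_chart X (psi x).
pose W' := W `&` psi @^-1` chart_dom c.
have oW' : open W' by apply: open_preimage_on => //; exact: chart_dom_open.
have W'x : W' x by split.
have hC1 : Ck_on 1 W' (c \o psi) by exact: spsi.
have [J sJ] := C1_strictly_differentiable oW' W'x hC1.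
have [N [G [oN Np sG gG]]] : exists (N : set M) (G : M -> 'rV[R]_n),
    [/\ open N, N (psi x), smooth_from X N G & {in (psi @` W) `&` N, G =1 g}].
  by apply: sg; exists x.
have oI : open (c @` (N `&` chart_dom c)) by exact: chart_image_open.
have Ih : (c @` (N `&` chart_dom c)) ((c \o psi) x) by exists (psi x).
have [J' sJ'] := C1_strictly_differentiable oI Ih (sG c ac 1%N).
have [L [d [L0 d0 GL]]] := strictly_differentiable_lipschitz sJ'.
have near1 : nbhs x (W' `&` (psi @^-1` N `&` [set y | `|(c \o psi) y - (c \o psi) x| < d])).
  apply: filterI; first exact: open_nbhs_nbhs.
  apply: filterI; first by apply: (cpsi _ (mem_set Wx)); exact: open_nbhs_nbhs.
  have [ch _] := hC1; have /cvgrPdist_lt := ch _ (mem_set W'x).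
  by move=> /(_ _ d0); apply: filterS => y; rewrite distrC.
have [r r0 rP] : exists2 r : R, 0 < r & forall y, `|y - x| < r ->
    [/\ W' y, N (psi y) & `|(c \o psi) y - (c \o psi) x| < d].
  move: near1 => /nbhs_ballP[r /= r0 H]; exists r => // y yr.
  by have [|? []] := H y; rewrite -?ball_normE //= distrC.
have expand y : `|y - x| < r -> `|y - x| <= L * `|(c \o psi) y - (c \o psi) x|.
  have GE z : `|z - x| < r -> (G \o chart_inv c) ((c \o psi) z) = z.
    move=> /rP[[Wz zd] Nz _] /=; rewrite (chart_mapK (mem_set zd)).
    rewrite gG; last by apply: mem_set; split=> //; exists z.
    exact: gK (mem_set Wz).
  move=> yr; have xr : `|x - x| < r by rewrite subrr normr0.
  rewrite -{1}(GE _ yr) -{1}(GE _ xr); apply: GL; last by rewrite subrr normr0.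
  by have [] := rP _ yr.
have Ju := strictly_differentiable_unitmx sJ L0 r0 expand.
have ch y : `|y - x| < r -> {for y, continuous (c \o psi)}.
  by move=> /rP[W'y _ _]; have [ch _] := hC1; exact: ch (mem_set W'y).
have [r' r'0 r'P] : exists2 r' : R, 0 < r' & forall y, `|y - x| < r' -> U y.
  move: xU => /nbhs_ballP[r' /= r'0 H]; exists r' => // y yr.
  by apply: H; rewrite -ball_normE /= distrC.
have [q q0 /andP[qr qr']] := exists_pos_lt2 r0 r'0.
have [e e0 eP] := strictly_differentiable_surjective sJ Ju r0 ch q0.
have nb : nbhs (psi x) (chart_dom c `&` [set p | `|c p - c (psi x)| < e]).
  apply: filterI; first by apply: open_nbhs_nbhs; split => //; exact: chart_dom_open.
  have /cvgrPdist_lt := chart_continuous (mem_set px).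
  by move=> /(_ _ e0); apply: filterS => p; rewrite distrC.
apply: filterS nb => p [pd /eP[y yx hy]].
have [[Wy yd] _ _] := rP _ (lt_trans yx qr).
exists y; first by split=> //; apply: r'P; exact: lt_trans qr'.
exact: chart_inj (mem_set yd) (mem_set pd) hy.
Qed.

Variable T : smooth_triangulation X.
Notation tri := (@tri R n M X T).

Lemma chart_simplex_box_dim l (phi : simplex R l -> M) (c : chart R n M) p (r : R) :
  tri phi -> atlas X c ->
  (forall y, `|y - p| <= r -> (c @` chart_dom c) y) ->
  box_dim_le l [set y | `|y - p| <= r /\ range phi (chart_inv c y)].
Proof.
move=> t ac rd; have [W [psi E]] := tri_extends t.
have [oW sW [[cpsi spsi] _] _] := E.
pose K := chart_inv c @` [set y | `|y - p| <= r].
have clK : closed K.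
  apply: compact_closed; first exact: manifold_hausdorff X.
  apply: continuous_compact; last exact: closed_ball_compact.
  by apply: continuous_in_subspaceT => y /set_mem /rd yd; apply: chart_inv_at; exact: mem_set.
pose A := simplex R l `&` psi @^-1` K.
have clA : closed A.
  move=> x cx; have sx : simplex R l x.
    by apply: (@simplex_closed R l); apply: closure_subset cx => y [].
  split=> //; apply: clK => N xN.
  have [y [[sy Ky] Ny]] := cx _ (cpsi _ (mem_set (sW _ sx)) _ xN).
  by exists (psi y).
have cA : compact A by apply: subclosed_compact clA (@simplex_compact R l) _ => x [].
have oW' : open (W `&` psi @^-1` chart_dom c).
  by apply: open_preimage_on => //; exact: chart_dom_open.
have AW' : A `<=` W `&` psi @^-1` chart_dom c.
  move=> x [sx [y /rd yd yx]]; split; first exact: sW.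
  by rewrite /= -yx; have [] := chart_invK yd.
have := box_dim_le_C1_image oW' AW' cA (spsi c ac 1%N).
apply: box_dim_le_sub => y [yr]; rewrite (extends_range E) => -[x sx xy].
exists x; first by split=> //; exists y.
by rewrite /= xy; have [] := chart_invK (rd _ yr).
Qed.

Lemma chart_skeleton_box_dim k d (c : chart R n M) p (r : R) : atlas X c ->
  (forall y, `|y - p| <= r -> (c @` chart_dom c) y) ->
  (forall l, (l < d)%N -> (l <= k)%N) ->
  box_dim_le k [set y | `|y - p| <= r /\
    exists l (phi : simplex R l -> M), [/\ (l < d)%N, tri phi & range phi (chart_inv c y)]].
Proof.
move=> ac rd dk.
apply: (@box_dim_le_sub _ _ _ _ (\bigcup_(l in `I_d) \bigcup_(phi in @Defs.tri R n M X T l)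
    [set y | `|y - p| <= r /\ range phi (chart_inv c y)])).
  by move=> y [yr [l [phi [ld t ry]]]]; exists l => //; exists phi.
apply: box_dim_le_bigcup => [|l ld]; first exact: finite_II.
apply: box_dim_le_bigcup => [|phi t]; first exact: tri_finite.
by apply: box_dim_le_leq (dk _ ld) _; exact: chart_simplex_box_dim.
Qed.

(** The simplexes of dimension less than n have box dimension less than n in a
    chart, hence cannot cover a ball. *)
Lemma top_simplexes_dense (O : set M) p : open O -> O p ->
  exists2 phi : simplex R n -> M, tri phi & exists2 q, O q & open_simplex phi q.
Proof.
move=> oO Op; apply: contrapT => nE.
have low q : O q -> exists l (phi : simplex R l -> M),
    [/\ (l < n)%N, tri phi & range phi q].
  move=> Oq; have [l [phi [t o]]] := tri_point T q.
  exists l, phi; split=> //; last exact: open_simplex_range.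
  rewrite ltn_neqAle (tri_le t) andbT; apply/eqP => ln; apply: nE.
  by subst l; exists phi => //; exists q.
have [c ac pd] := atlas_chart X p.
have [r r0 rP] := chart_ball pd (open_nbhs_nbhs (conj oO Op)).
have r20 : 0 < r / 2 by rewrite divr_gt0.
have rr : r / 2 < r by move: r0; lra.
have rP' y : `|y - c p| <= r / 2 -> (c @` chart_dom c) y.
  by move=> yr; have [] := rP y (le_lt_trans yr rr).
have [n0|n0] := posnP n.
  by have [l [phi [ln _ _]]] := low _ Op; move: ln; rewrite n0.
have dk l : (l < n)%N -> (l <= n.-1)%N by move=> ln; rewrite -ltnS prednK.
have := chart_skeleton_box_dim ac rP' dk.
move=> /box_dim_le_ball; apply; [by rewrite prednK | exact: r20 |].
move=> y yr; split; first exact: yr.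
by apply: low; have [] := rP y (le_lt_trans yr rr).
Qed.

Lemma top_simplexes_cover p : exists2 phi : simplex R n -> M, tri phi & range phi p.
Proof.
apply: contrapT => nE.
have cl : closed (\bigcup_(phi in @Defs.tri R n M X T n) range phi).
  by apply: closed_bigcup => [|phi t]; [exact: tri_finite | exact: tri_range_closed t].
have [|phi t [q nq oq]] := top_simplexes_dense (closed_openC cl) (p := p).
  by move=> [phi t r]; apply: nE; exists phi.
by apply: nq; exists phi => //; exact: open_simplex_range.
Qed.

Lemma top_simplex_chart_ball (phi : simplex R n -> M) (c : chart R n M) p (r : R) :
  tri phi -> range phi p -> chart_dom c p -> 0 < r ->
  (forall y, `|y - c p| < r -> (c @` chart_dom c) y) ->
  exists a, exists2 d : R, 0 < d &
    forall y, `|y - a| <= d -> `|y - c p| < r /\ open_simplex phi (chart_inv c y).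
Proof.
move=> t rp pd r0 rP1.
have Np : nbhs p (chart_dom c `&` [set q | `|c q - c p| < r]).
  apply: filterI; first by apply: open_nbhs_nbhs; split => //; exact: chart_dom_open.
  have /cvgrPdist_lt := chart_continuous (mem_set pd).
  by move=> /(_ _ r0); apply: filterS => q; rewrite distrC.
have [W [psi E]] := tri_extends t.
have [q oq [qd qr]] := extends_dense E rp Np.
have [d d0 dP] := chart_ball qd (open_nbhs_nbhs (conj (tri_top_open t) oq)).
have dr0 : 0 < r - `|c q - c p| by rewrite subr_gt0.
have [e e0 /andP[ed er]] := exists_pos_lt2 d0 dr0.
exists (c q), e => // y ye; have [_ oy] := dP y (le_lt_trans ye ed); split=> //.
have -> : y - c p = (y - c q) + (c q - c p) by rewrite addrA subrK.
apply: (le_lt_trans (ler_normD _ _)); rewrite -ltrBrDr.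
exact: le_lt_trans er.
Qed.

End Charts.

(** * Simplexes of codimension 1 *)

Section Codimension1.
Variables (R : realType) (m : nat) (M : topologicalType).
Notation n := m.+1.
Variable X : smooth_manifold R n M.
Variable T : smooth_triangulation X.
Notation tri := (@tri R n M X T).

Lemma range_nonempty l (phi : simplex R l -> M) : range phi !=set0.
Proof.
exists (phi (exist (fun y => y \in simplex R l) _
  (mem_set (interior_subset (@center_interior R l))))).
by eexists.
Qed.

(** The points hidden from a by the simplexes of codimension at least 2 form a
    cone of box dimension at most n - 1, which does not contain a ball
    around b. Since those simplexes keep at distance d from a, bounded factors
    suffice to describe the cone. *)
Lemma segment_avoids_skeleton (c : chart R n M) (p : M) (r : R) a b (d e : R) : atlas X c ->
  (forall y, `|y - c p| <= r -> (c @` chart_dom c) y) ->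
  0 < d -> 0 < e ->
  (forall y, `|y - a| <= d -> `|y - c p| < r /\
     forall l (phi : simplex R l -> M), (l < n)%N -> tri phi -> ~ range phi (chart_inv c y)) ->
  (forall y, `|y - b| <= e -> `|y - c p| < r) ->
  exists2 b', `|b' - b| <= e & forall t, 0 <= t <= 1 ->
    `|(1 - t) *: a + t *: b' - c p| < r /\
    forall l (phi : simplex R l -> M), (l < m)%N -> tri phi ->
      ~ range phi (chart_inv c ((1 - t) *: a + t *: b')).
Proof.
move=> ac rP d0 e0 aP bP.
have [m0|m0] := posnP m.
  exists b; first by rewrite subrr normr0 ltW.
  move=> t /andP[t0 t1]; split=> [|l phi]; last by rewrite [in X in (_ < X)%N]m0.
  have -> : (1 - t) *: a + t *: b - c p = (1 - t) *: (a - c p) + t *: (b - c p).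
    by apply/rowP => i; rewrite !mxE; ring.
  apply: convex_ball => //; last by apply: bP; rewrite subrr normr0 ltW.
  by have [] := aP a; rewrite // subrr normr0 ltW.
have a_r : `|a - c p| < r by have [] := aP a; rewrite // subrr normr0 ltW.
have b_r : `|b - c p| < r by apply: bP; rewrite subrr normr0 ltW.
have dk l : (l < m)%N -> (l <= m.-1)%N by move=> lm; rewrite -ltnS prednK.
have Sdim := chart_skeleton_box_dim T ac rP dk.
set S := [set y | _] in Sdim.
pose D := (truncn (2 * r)).+1; pose N := (truncn (2 * r / d)).+1.
have DP : 2 * r < D%:R by exact: truncnS_gt.
have NP : 2 * r / d < N%:R by exact: truncnS_gt.
have two y z : `|y - c p| <= r -> `|z - c p| <= r -> `|y - z| <= 2 * r.
  move=> yr zr; have -> : y - z = (y - c p) - (z - c p) by rewrite opprB addrA subrK.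
  by apply: le_trans (ler_normB _ _) _; rewrite mulrDl mul1r lerD.
have SD x : S x -> `|x - a| <= D%:R.
  by move=> [xr _]; apply: le_trans (ltW DP); apply: two => //; exact: ltW.
have := box_dim_le_cone N Sdim SD; set K := [set y | _] => Kdim.
have [b' b'e nK] : exists2 b', `|b' - b| <= e & ~ K b'.
  apply: contrapT => nE; apply: (box_dim_le_ball (a := b) (r := e) Kdim _ e0).
    by rewrite prednK.
  by move=> y ye; apply: contrapT => nK; apply: nE; exists y.
exists b' => // t /andP[t0 t1].
set x := (1 - t) *: a + t *: b'.
have xr : `|x - c p| < r.
  have -> : x - c p = (1 - t) *: (a - c p) + t *: (b' - c p).
    by apply/rowP => i; rewrite !mxE; ring.
  by apply: convex_ball => //; exact: bP.
split=> // l phi lm tphi rphi; apply: nK.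
have xd : d < `|x - a|.
  rewrite ltNge; apply/negP => xd; have [_ H] := aP _ xd.
  by apply: (H l phi) rphi => //; exact: ltnW.
have xE : x - a = t *: (b' - a) by apply/rowP => i; rewrite !mxE; ring.
have tN0 : t != 0.
  by apply/negP => /eqP tz; move: xd; rewrite xE tz scale0r normr0 ltNge ltW.
have tp : 0 < t by rewrite lt_neqAle eq_sym tN0.
exists x, t^-1; split.
- by split; [exact: ltW | exists l, phi].
- by rewrite invr_ge0.
- apply: le_trans (ltW NP); rewrite ler_pdivlMr // mulrC ler_pdivrMr //.
  have := two b' a (ltW (bP _ b'e)) (ltW a_r).
  move=> /(ler_wpM2l t0); move: xd; rewrite xE normrZ (ger0_norm t0) => h1 h2.
  by rewrite mulrC; exact: le_trans (ltW h1) h2.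
- by rewrite xE scalerA mulVf // scale1r addrC subrK.
Qed.

(** Otherwise the union U of the closed simplexes of S and the union V of the
    others would only meet in codimension at least 2. By connectedness they
    meet at some p; a segment close to p going from U to V and avoiding the
    simplexes of codimension at least 2 crosses U and V simultaneously, at a
    point of codimension 1. *)
Lemma strongly_connected (S : set (simplex R n -> M)) :
  connected [set: M] -> S `<=` @Defs.tri R n M X T n -> S !=set0 ->
  (exists2 phi : simplex R n -> M, tri phi & ~ S phi) ->
  exists phi phi' i i', [/\ S phi, tri phi', ~ S phi' &
    phi \o @face R m i = phi' \o @face R m i'].
Proof.
move=> conM Stri [phi0 S0] [phi1 t1 S1].
pose cell (A : set (simplex R n -> M)) := \bigcup_(phi in A) range phi.
pose U := cell S; pose V := cell [set phi | tri phi /\ ~ S phi].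
have cell_closed A : A `<=` @Defs.tri R n M X T n -> closed (cell A).
  move=> At; apply: closed_bigcup => [|phi /At]; last exact: tri_range_closed.
  exact: sub_finite_set At (tri_finite T n).
have cU : closed U by exact: cell_closed.
have cV : closed V by apply: cell_closed => phi [].
have UV q : U q \/ V q.
  have [phi t r] := top_simplexes_cover T q.
  by have [Sp|Sp] := pselect (S phi); [left|right]; exists phi.
have [p [Up Vp]] : exists p, U p /\ V p.
  apply: contrapT => nUV.
  have : U = setT.
    apply: conM.
    - have [q r] : range phi0 !=set0 by exact: range_nonempty.
      by exists q, phi0.
    - exists (~` V); first exact: closed_openC.
      rewrite setTI; apply/seteqP; split=> q; first by move=> Uq Vq; apply: nUV; exists q.
      by case: (UV q).
    - by exists U => //; rewrite setTI.
  have [q r] : range phi1 !=set0 by exact: range_nonempty.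
  move=> UT; apply: nUV; exists q; split; first by rewrite UT.
  by exists phi1.
have [c ac pd] := atlas_chart X p.
have [r' r'0 rP'] := chart_ball pd (@filterT _ _ (nbhs_filter p)).
pose r := r' / 2.
have r0 : 0 < r by rewrite divr_gt0.
have rP y : `|y - c p| <= r -> (c @` chart_dom c) y.
  by move=> yr; have [] := rP' y; rewrite // (le_lt_trans yr) // /r; move: r'0; lra.
have rP1 y : `|y - c p| < r -> (c @` chart_dom c) y by move=> /ltW; exact: rP.
have [phi Sphi rphi] := Up; have [phi' [tphi' Sphi'] rphi'] := Vp.
have tphi := Stri _ Sphi.
have [a [d d0 aP]] := top_simplex_chart_ball tphi rphi pd r0 rP1.
have [b [e e0 bP]] := top_simplex_chart_ball tphi' rphi' pd r0 rP1.
have [||b' b'e segP] := @segment_avoids_skeleton c p r a b d e ac rP d0 e0.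
- move=> y /aP[yr oy]; split=> // l tau ln tt rt.
  by have := range_dim tt tphi rt oy; rewrite leqNgt ln.
- by move=> y /bP[].
have [||||t t01 [Ut Vt]] := @segment_closed_meet R M
    (fun t => chart_inv c ((1 - t) *: a + t *: b')) U V _ cU cV.
- move=> t t01; apply: (@continuous_comp _ _ _ (fun t : R => (1 - t) *: a + t *: b')).
    exact: affine_continuous.
  by apply: chart_inv_at; apply: mem_set; apply: rP1; have [] := segP t t01.
- rewrite subr0 scale1r scale0r addr0; exists phi => //; apply: open_simplex_range.
  by have [] := aP a; rewrite // subrr normr0 ltW.
- rewrite subrr scale1r scale0r add0r; exists phi' => //; apply: open_simplex_range.
  by have [] := bP b'.
- by move=> t t01; exact: UV.
set q := chart_inv c _ in Ut Vt.
have [_ avoid] := segP t t01.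
have [phi2 S2 r2] := Ut; have [phi3 [t3 S3] r3] := Vt; have t2 := Stri _ S2.
have [l [tau [tt ot]]] := tri_point T q.
have [lm|ml] := ltnP l m.
  by case: (avoid l tau lm tt); exact: open_simplex_range.
have [lm|lm] := eqVneq l m.
  subst l; have [i ei] := range_facet_eq t2 tt r2 ot.
  have [j ej] := range_facet_eq t3 tt r3 ot.
  by exists phi2, phi3, i, j; rewrite ei ej.
have ln : l = m.+1 by apply/eqP; rewrite eqn_leq (tri_le tt) ltn_neqAle eq_sym lm.
subst l; case: S3.
by rewrite (range_open_eq t3 tt r3 ot) -(range_open_eq t2 tt r2 ot).
Qed.

Lemma codim1_star_open (sigma : simplex R m -> M) : tri sigma ->
  open (open_simplex sigma `|` \bigcup_(phi in [set phi : simplex R n -> M |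
    tri phi /\ exists i, phi \o @face R m i = sigma]) open_simplex phi).
Proof.
move=> ts; apply: (open_star (T := T)) => l tau q tt r.
case=> [os|[phi [tphi [i fi]] o]].
  have ml := range_dim tt ts r os.
  have [E|ne] := eqVneq l m; first by subst l; rewrite (range_open_eq tt ts r os); left.
  have {ml}ln : l = n.
    by apply/eqP; rewrite eqn_leq (tri_le tt) ltn_neqAle eq_sym ne.
  subst l; have fi := range_facet_eq tt ts r os.
  by move=> q' o'; right; exists tau.
have ln : l = n by apply/eqP; rewrite eqn_leq (tri_le tt) (range_dim tt tphi r o).
by subst l; rewrite (range_open_eq tt tphi r o) => q' o';
  right; exists phi => //; split=> //; exists i.
Qed.

(** Extend phi1 to a neighborhood of an interior point x of the shared facet;
    by [diffeo_open_map] it maps small balls onto neighborhoods of the image of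
    x. The half of a small ball beyond the facet is connected and avoids the
    closed simplex of phi1, so it lies in a single other open coface, whereas
    both phi2 and phi3 are reached from it. *)
Lemma at_most_two_cofaces (phi1 phi2 phi3 : simplex R n -> M) i1 i2 i3 :
  tri phi1 -> tri phi2 -> tri phi3 ->
  phi1 \o @face R m i1 = phi2 \o @face R m i2 ->
  phi1 \o @face R m i1 = phi3 \o @face R m i3 ->
  [\/ phi1 = phi2, phi1 = phi3 | phi2 = phi3].
Proof.
move=> t1 t2 t3 f2 f3; set sigma := phi1 \o _ in f2 f3.
have ts : tri sigma by exact: tri_face.
have [->|n12] := pselect (phi1 = phi2); first by constructor 1.
have [->|n13] := pselect (phi1 = phi3); first by constructor 2.
have [->|n23] := pselect (phi2 = phi3); first by constructor 3.
exfalso.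
have [W [psi E]] := tri_extends t1; have [oW sW dpsi _] := E.
pose z := center R m; pose x := face_map i1 z.
have sz : simplex R m z by exact: interior_subset (@center_interior R m).
have sx : simplex R n x by exact: face_map_simplex.
pose zz : simplex R m := exist (fun y => y \in simplex R m) z (mem_set sz).
have px : psi x = sigma zz by rewrite /sigma (face_simplex _ _ E).
have os : open_simplex sigma (psi x) by exists zz => //; exact: center_interior.
pose St : set M := open_simplex sigma `|` \bigcup_(phi in [set phi : simplex R n -> M |
    tri phi /\ exists i, phi \o @face R m i = sigma]) open_simplex phi.
have oSt : open St by exact: codim1_star_open.
(* a small ball around x maps into the star and stays on the inner side of
   all facets but the i1-th *)
have xB : nbhs x (W `&` (psi @^-1` St `&` [set y | forall k, 0 < barycentric y (lift i1 k)])).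
  apply: filterI; first by apply: open_nbhs_nbhs; split => //; exact: sW.
  apply: filterI.
    apply: (extends_continuous E (mem_set (sW _ sx))).
    by apply: open_nbhs_nbhs; split => //; left.
  apply: (filter_forall (nbhs_filter x)) => k.
  apply: (@bary_continuous R n (lift i1 k) x [set r | 0 < r]).
  apply: open_nbhs_nbhs; split; first exact: open_gt.
  by rewrite /= bary_face_lift bary_center invr_gt0.
have [r r0 rP] : exists2 r : R, 0 < r & forall y, `|y - x| < r ->
    [/\ W y, St (psi y) & forall k, 0 < barycentric y (lift i1 k)].
  move: xB => /nbhs_ballP[r /= r0 H]; exists r => // y yr.
  by have [|? []] := H y; rewrite -?ball_normE //= distrC.
have xN : nbhs x [set y | `|y - x| < r].
  apply/nbhs_ballP; exists r => // y; rewrite -ball_normE /= distrC.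
  exact.
have nb := diffeo_open_map oW dpsi (sW _ sx) xN.
(* both other cofaces are reached from the outer side of the i1-th facet *)
have outer phi i : tri phi -> sigma = phi \o @face R m i -> phi1 <> phi ->
    exists u, [/\ `|u - x| < r, barycentric u i1 < 0 & open_simplex phi (psi u)].
  move=> t fi n1; have [W' [psi' E']] := tri_extends t.
  have rx : range phi (psi x) by rewrite px fi; exists (face i zz).
  have [q oq [u [Wu ur] uq]] := extends_dense E' rx nb.
  exists u; split; [exact: ur | | by rewrite uq].
  rewrite ltNge; apply/negP => u0; apply: n1.
  apply: (range_open_eq t1 t) oq; rewrite (extends_range E); exists u => //.
  apply/simplexP => j; case: (unliftP i1 j) => [k|] -> //.
  by apply: ltW; have [_ _] := rP _ ur; exact.
have [u [ur u0 ou]] := outer _ _ t2 f2 n12.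
have [v [vr v0 ov]] := outer _ _ t3 f3 n13.
pose path t := psi ((1 - t) *: u + t *: v).
have pathr (t : R) : 0 <= t <= 1 -> `|(1 - t) *: u + t *: v - x| < r.
  move=> /andP[t0 t1'].
  have -> : (1 - t) *: u + t *: v - x = (1 - t) *: (u - x) + t *: (v - x).
    by apply/rowP => i; rewrite !mxE; ring.
  exact: convex_ball.
pose O := \bigcup_(phi in [set phi : simplex R n -> M | tri phi /\ phi <> phi2]) open_simplex phi.
have oO : open O by apply: bigcup_open => phi [t _]; exact: tri_top_open t.
have [||||t t01 [q2 [phi [tp n2] o]]] := @segment_open_meet R M path _ _ _
    (tri_top_open t2) oO.
- move=> t t01; apply: (@continuous_comp _ _ _ (fun t : R => (1 - t) *: u + t *: v)).
    exact: affine_continuous.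
  by apply: (extends_continuous E); apply: mem_set; have [] := rP _ (pathr t t01).
- by rewrite /path subr0 scale1r scale0r addr0.
- rewrite /path subrr scale1r scale0r add0r; exists phi3 => //; split=> //.
  by move=> /esym.
- move=> t t01; have [Wt St_t _] := rP _ (pathr t t01).
  have neg : barycentric ((1 - t) *: u + t *: v) i1 < 0.
    rewrite bary_affine; have /andP[t0 t1'] := t01.
    have [->|tN0] := eqVneq t 0; first by rewrite subr0 mul1r mul0r addr0.
    have tp : 0 < t by rewrite lt_neqAle eq_sym tN0.
    apply: ltr_wnDl; first by rewrite mulr_ge0_le0 ?subr_ge0 // ltW.
    by rewrite pmulr_rlt0.
  have n1 : ~ range phi1 (path t).
    rewrite (extends_range E) => -[y sy].
    move=> /(extends_inj E (mem_set (sW _ sy)) (mem_set Wt)) yE.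
    by move/simplexP: sy => /(_ i1); rewrite yE leNgt neg.
  case: St_t => [q_o|[phi [t' _] q_o]].
    by case: n1; apply: (facet_range (i := i1)); exact: open_simplex_range.
  have [e2|n2] := pselect (phi = phi2); first by left; rewrite -e2.
  by right; exists phi.
by apply: n2; exact: (tri_eq tp t2 o q2).
Qed.

End Codimension1.

(** * Growing the cell *)

Section TopCell.
Variables (R : realType) (n : nat) (M : topologicalType).
Variable X : smooth_manifold R n M.
Variable T : smooth_triangulation X.
Notation tri := (@tri R n M X T).

Lemma open_simplex_homeomorphic l (phi : simplex R l -> M) : tri phi ->
  homeomorphic (open_simplex phi) (simplex R l)°.
Proof.
move=> t; have [W [psi E]] := tri_extends t; rewrite (extends_open E).
have [oW sW _ _] := E.
have inj := extends_inj_simplex E.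
have /choice[g gP] : forall q, exists x, (psi @` (simplex R l)°) q ->
    (simplex R l)° x /\ psi x = q.
  move=> q; have [[x sx xq]|nq] := pselect ((psi @` (simplex R l)°) q); first by exists x.
  by exists 0.
have gK x : (simplex R l)° x -> g (psi x) = x.
  move=> sx; have [|gx e] := gP (psi x); first by exists x.
  by apply: inj e; apply: mem_set; exact: interior_subset.
apply: (homeomorphic_of (f := g) (g := psi)).
- by move=> q /gP[].
- by move=> x sx; exists x.
- by move=> q /gP[].
- exact: gK.
- move=> _ [x sx <-] N; rewrite gK // => xN.
  have := compact_inverse_nbhs (manifold_hausdorff X) (@simplex_compact R l)
    (extends_within E) inj (interior_subset sx) xN.
  apply: filterS => q H [y sy yq]; rewrite -yq gK //.
  by apply: H; [exact: interior_subset | ].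
- move=> x sx N xN; have := within_nbhs (extends_within E) (interior_subset sx) xN.
  by apply: filterS => y H sy; apply: H; exact: interior_subset.
Qed.

End TopCell.

Section Growth.
Variables (R : realType) (m : nat) (M : topologicalType).
Notation n := m.+1.
Variable X : smooth_manifold R n M.
Variable T : smooth_triangulation X.
Notation tri := (@tri R n M X T).
Implicit Types (S : set (simplex R n -> M)) (E : set (simplex R m -> M)).

Definition opened S E : set M :=
  \bigcup_(phi in S) open_simplex phi `|` \bigcup_(sigma in E) open_simplex sigma.

(** [growth S E] says that the simplexes of S have been glued together across
    the walls of E. The field [growth_coface] means that walls are only opened
    between members of S, so that adding a new simplex creates no cycle. The
    field [growth_wall] is what makes the final complement a union of closed
    (n-1)-simplexes: a point of codimension at least 2 always lies in a wall
    that remains closed. *)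
Record growth S E : Prop := Growth {
  growth_tri : S `<=` @Defs.tri R n M X T n;
  growth_wall_tri : E `<=` @Defs.tri R n M X T m;
  growth_cell : homeomorphic (opened S E) (simplex R n)°;
  growth_coface : forall phi i, tri phi -> E (phi \o @face R m i) -> S phi;
  growth_wall : forall q, (exists2 phi, S phi & range phi q) ->
    (forall phi : simplex R n -> M, tri phi -> ~ open_simplex phi q) ->
    (forall sigma : simplex R m -> M, tri sigma -> ~ open_simplex sigma q) ->
    exists phi i, [/\ S phi, ~ E (phi \o @face R m i) &
                      range (phi \o @face R m i) q] }.

(** In corner coordinates at the vertex opposite to a facet, that facet is
    where the coordinates sum to 1. *)
Lemma facet_corner (phi : simplex R n -> M) W psi i (x : 'rV[R]_n) :
  extends X phi W psi -> simplex R n x -> radius x = 1 ->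
  exists2 z : simplex R m, psi (corner_map i x) = (phi \o face i) z &
    forall k, barycentric (val z) k = x 0 k.
Proof.
move=> E sx x1.
have [||z [sz zx zE]] := @face_map_surj R m i (corner_map i x).
- exact/corner_map_simplex.
- by rewrite bary_corner_self -/(radius x) x1 subrr.
exists (exist (fun y => y \in simplex R m) z (mem_set sz)).
  by rewrite (face_simplex _ _ E) /= zx.
by move=> k /=; rewrite zE bary_corner_lift.
Qed.

Lemma corner_open (phi : simplex R n -> M) W psi i : extends X phi W psi ->
  (psi \o corner_map i) @` (simplex R n)° = open_simplex phi.
Proof.
move=> E; rewrite (extends_open E); apply/seteqP; split=> q [x sx xq].
  by exists (corner_map i x) => //; apply/corner_map_interior.
exists (corner_coord i x); last by rewrite /= corner_coordK.
by apply/(corner_map_interior i); rewrite corner_coordK.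
Qed.

Lemma corner_wall (phi : simplex R n -> M) W psi i : extends X phi W psi ->
  (psi \o corner_map i) @` [set x | orthant x /\ radius x = 1] =
  open_simplex (phi \o @face R m i).
Proof.
move=> E; apply/seteqP; split=> q.
  move=> [x [x0 x1] xq].
  have sx : simplex R n x by apply: orthant_simplex => //; rewrite x1.
  have [z zE zx] := facet_corner i E sx x1.
  exists z; last by rewrite -zE.
  by apply/simplex_interiorP => k; rewrite zx.
move=> [z sz zq]; pose x : 'rV[R]_n := \row_k barycentric (val z) k.
have x1 : radius x = 1.
  by rewrite -(bary_sum1 (val z)); apply: eq_bigr => k _; rewrite mxE.
exists x.
  by split => // k; rewrite mxE; move/simplex_interiorP: sz; exact.
by rewrite -zq (face_simplex _ _ E) /= face_map_corner.
Qed.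

(** The cell grows by [glue_simplex]; the closed simplex phi' misses the old
    cell because no wall of phi' is open yet. For [growth_wall]: a point of phi'
    of codimension at least 2 lies in two distinct facets of phi', of which
    only one is opened. *)
Lemma growth_step S E phi phi' i i' : growth S E ->
  S phi -> tri phi' -> ~ S phi' ->
  phi \o @face R m i = phi' \o @face R m i' ->
  growth (S `|` [set phi']) (E `|` [set phi' \o @face R m i']).
Proof.
move=> G Sphi t' nS' ff; set sigma := phi' \o _.
have t := growth_tri G Sphi.
have ts : tri sigma by exact: tri_face.
have n' : phi <> phi' by move=> e; apply: nS'; rewrite -e.
have coface phi2 j : tri phi2 -> phi2 \o @face R m j = sigma -> phi2 = phi \/ phi2 = phi'.
  move=> t2 fj.
  have [] := at_most_two_cofaces t t' t2 ff (etrans ff (esym fj)).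
  - by [].
  - by left.
  - by right.
have avoid q : range phi' q -> ~ opened S E q.
  move=> r [[phi2 S2 o]|[sigma2 E2 o]].
    by apply: nS'; rewrite (range_open_eq t' (growth_tri G S2) r o).
  have [j ej] := range_facet_eq t' (growth_wall_tri G E2) r o.
  by apply: nS'; apply: (growth_coface G (i := j)) => //; rewrite ej.
split.
- by move=> phi2 [/(growth_tri G)|->].
- by move=> sigma2 [/(growth_wall_tri G)|->].
- apply: homeomorphic_trans (growth_cell G).
  have [W [psi F]] := tri_extends t; have [W' [psi' F']] := tri_extends t'.
  pose P := psi \o corner_map i; pose Q := psi' \o corner_map i'.
  have Pint : P @` (simplex R n)° = open_simplex phi by exact: corner_open F.
  have Qint : Q @` (simplex R n)° = open_simplex phi' by exact: corner_open F'.
  have Pwall : P @` [set x | orthant x /\ radius x = 1] = open_simplex sigma.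
    by rewrite /sigma -ff; exact: corner_wall F.
  have Qrange x : simplex R n x -> range phi' (Q x).
    by move=> sx; rewrite (extends_range F'); exists (corner_map i' x) => //;
      apply/corner_map_simplex.
  have -> : opened (S `|` [set phi']) (E `|` [set sigma]) =
      opened S E `|` P @` [set x | orthant x /\ radius x = 1] `|` Q @` (simplex R n)°.
    rewrite Pwall Qint /opened !bigcup_setU !bigcup_set1.
    by rewrite setUACA [open_simplex phi' `|` _]setUC setUA.
  have corner_within psi0 W0 phi0 j : extends X phi0 W0 psi0 ->
      {within simplex R n, continuous (psi0 \o corner_map j)}.
    move=> F0; apply: continuous_in_subspaceT => x /set_mem sx.
    apply: continuous_comp; first exact: corner_map_continuous.
    apply: (extends_continuous F0); apply: mem_set; have [_ sW _ _] := F0.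
    by apply: sW; apply/corner_map_simplex.
  have corner_inj psi0 W0 phi0 j : extends X phi0 W0 psi0 ->
      {in simplex R n &, injective (psi0 \o corner_map j)}.
    move=> F0 x y /set_mem sx /set_mem sy /= /(extends_inj_simplex F0) e.
    apply: (can_inj (corner_mapK j)); apply: e; apply: mem_set;
    exact/corner_map_simplex.
  apply: glue_simplex.
  + exact: manifold_hausdorff X.
  + exact: corner_within F.
  + exact: corner_within F'.
  + exact: corner_inj F.
  + exact: corner_inj F'.
  + move=> x sx x1; have [z zE zx] := facet_corner i F sx x1.
    have [z' zE' zx'] := facet_corner i' F' sx x1.
    rewrite /P /Q /= zE zE' ff; congr (_ _); apply/val_inj/bary_inj => k.
    by rewrite zx zx'.
  + by move=> x sx; apply: avoid; exact: Qrange.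
  + move=> x y sx sy e; apply: n'.
    have r : range phi (P x).
      by rewrite (extends_range F); exists (corner_map i x) => //;
        apply/corner_map_simplex.
    by apply: (range_open_eq t t' r); rewrite e -Qint; exists y.
  + move=> x sx; left; exists phi => //; rewrite -Pint; by exists x.
  + by rewrite Pint; exact: tri_top_open t.
  + rewrite Pint Pwall Qint; apply: (open_star (T := T)) => l tau q tt r.
    case=> [[q_o|q_o]|q_o].
    * have ln : l = n by apply/eqP; rewrite eqn_leq (tri_le tt) (range_dim tt t r q_o).
      by subst l; rewrite (range_open_eq tt t r q_o) => q' o'; left; left.
    * have ml := range_dim tt ts r q_o.
      have [e|ne] := eqVneq l m.
        by subst l; rewrite (range_open_eq tt ts r q_o) => q' o'; left; right.
      have {ml}ln : l = n.
        by apply/eqP; rewrite eqn_leq (tri_le tt) ltn_neqAle eq_sym ne.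
      subst l; have [j fj] := range_facet_eq tt ts r q_o.
      by have [->|->] := coface _ _ tt fj; move=> q' o'; [left; left | right].
    * have ln : l = n by apply/eqP; rewrite eqn_leq (tri_le tt) (range_dim tt t' r q_o).
      by subst l; rewrite (range_open_eq tt t' r q_o) => q' o'; right.
- move=> phi2 j t2 [/(growth_coface G t2)|fj]; first by left.
  by have [->|->] := coface _ _ t2 fj; [left | right].
- move=> q [phi2 S2 r2] no1 no2.
  have [r'|nr'] := pselect (range phi' q).
    have [j [k [jk rj rk]]] : exists j k, [/\ j != k,
        range (phi' \o @face R m j) q & range (phi' \o @face R m k) q].
      apply: (two_facets t' r'); first exact: no1.
      by move=> j; apply: no2; exact: tri_face.
    have [j' [nj rj']] : exists j',
        phi' \o @face R m j' <> sigma /\ range (phi' \o @face R m j') q.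
      have [ej|nej] := pselect (phi' \o @face R m j = sigma); last by exists j.
      exists k; split=> // ek; move/eqP: jk; apply.
      by apply: (facet_inj t'); rewrite ej ek.
    exists phi', j'; split => //; first by right.
    by case=> // /(growth_coface G t').
  have S2' : S phi2 by case: S2 => // e; case: nr'; rewrite -e.
  have [phi3 [j [S3 nE r3]]] := growth_wall G (ex_intro2 _ _ phi2 S2' r2) no1 no2.
  exists phi3, j; split=> //; first by left.
  case=> // e; apply: nr'; rewrite e in r3.
  exact: facet_range r3.
Qed.

Lemma growth_start (phi : simplex R n -> M) : tri phi -> growth [set phi] set0.
Proof.
move=> t; split.
- by move=> _ ->.
- by [].
- rewrite /opened bigcup_set1 bigcup_set0 setU0.
  exact: open_simplex_homeomorphic t.
- by [].
- move=> q [_ -> r] no1 no2.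
  have [|j [k [_ rj _]]] := two_facets t r (no1 _ t).
    by move=> j; apply: no2; exact: tri_face.
  by exists phi, j; split.
Qed.

Lemma growth_full : [set: M] !=set0 -> connected [set: M] ->
  exists E, growth (@Defs.tri R n M X T n) E.
Proof.
move=> [p _] conM.
have [phi0 t0 _] := top_simplexes_cover T p.
have fin := tri_finite T n.
have [s sE] := (finite_seqP _).1 fin.
suff H k : exists S E, growth S E /\
    (S = @Defs.tri R n M X T n \/ exists u : seq (simplex R n -> M),
       [/\ uniq u, size u = k.+1 & [set` u] `<=` S]).
  have [S [E [G [<-|[u [uu us uS]]]]]] := H (size s); first by exists E.
  have := uniq_leq_size uu (s2 := s); rewrite us ltnn => H'.
  exfalso; suff : false by []; apply: H' => phi /uS /(growth_tri G).
  by rewrite sE.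
elim: k => [|k [S [E [G SS]]]].
  exists [set phi0], set0; split; first exact: growth_start.
  by right; exists [:: phi0]; split => // phi; rewrite /= mem_seq1 => /eqP.
case: SS => [SS|[u [uu us uS]]].
  by exists S, E; split=> //; left.
have [SS|nSS] := pselect (@Defs.tri R n M X T n `<=` S).
  exists S, E; split=> //; left; apply/seteqP; split=> //; exact: growth_tri G.
have [phi1 t1 S1] : exists2 phi : simplex R n -> M, tri phi & ~ S phi.
  apply: contrapT => nE; apply: nSS => phi t; apply: contrapT => nS.
  by apply: nE; exists phi.
have S0 : S !=set0.
  by case: u us uS {uu} => // phi u _ uS; exists phi; apply: uS; rewrite /= mem_head.
have [phi [phi' [i [i' [Sphi t' nS' ff]]]]] :=
  strongly_connected conM (growth_tri G) S0 (ex_intro2 _ _ phi1 t1 S1).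
exists (S `|` [set phi']), (E `|` [set phi' \o @face R m i']); split.
  exact: growth_step ff.
right; exists (phi' :: u); split=> //=.
- by rewrite uu andbT; apply/negP => /uS.
- by rewrite us.
- by move=> phi2 /=; rewrite in_cons => /orP[/eqP->|/uS]; [right | left].
Qed.

Lemma cell_decomposition : [set: M] !=set0 -> connected [set: M] ->
  exists C K : set M,
    [/\ [set: M] = C `|` K,
        C `&` K = set0,
        is_cell R n C &
        exists S : set (set M),
          [/\ finite_set S,
              (forall A, S A -> exists2 l : nat,
                 l.+1 = n & closed_simplexes T l A) &
              K = \bigcup_(A in S) A]].
Proof.
move=> M0 conM; have [E G] := growth_full M0 conM.
set S := @Defs.tri R n M X T n in G.
pose F := [set sigma : simplex R m -> M | tri sigma /\ ~ E sigma].
have finF : finite_set F by apply: sub_finite_set (tri_finite T m) => sigma [].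
pose K := \bigcup_(sigma in F) range sigma.
have CK : opened S E `&` K = set0.
  apply/seteqP; split=> // q [[[phi t o]|[sigma' E' o]] [sigma [ts nE] r]].
    by have := range_dim ts t r o; rewrite ltnn.
  by apply: nE; rewrite (range_open_eq ts (growth_wall_tri G E') r o).
have cover q : opened S E q \/ K q.
  have [[phi t o]|no1] := pselect
    (exists2 phi : simplex R n -> M, tri phi & open_simplex phi q).
    by left; left; exists phi.
  have [[sigma t o]|no2] := pselect
    (exists2 sigma : simplex R m -> M, tri sigma & open_simplex sigma q).
    have [Es|nEs] := pselect (E sigma); first by left; right; exists sigma.
    by right; exists sigma => //; exact: open_simplex_range.
  have [phi t r] := top_simplexes_cover T q.
  have [||phi' [i [t' nE r']]] := growth_wall G (ex_intro2 _ _ phi t r).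
  - by move=> phi' t' o; apply: no1; exists phi'.
  - by move=> sigma t' o; apply: no2; exists sigma.
  by right; exists (phi' \o @face R m i) => //; split=> //; exact: tri_face.
exists (opened S E), K; split=> //.
- by apply/seteqP; split=> // q _; exact: cover.
- split; last exact: growth_cell G.
  have -> : opened S E = ~` K.
    apply/seteqP; split=> q; last by case: (cover q).
    by move=> Cq Kq; have : (opened S E `&` K) q by []; rewrite CK.
  apply: closed_openC; apply: closed_bigcup => // sigma [ts _].
  exact: tri_range_closed ts.
exists [set range sigma | sigma in F]; split.
- exact: finite_image.
- by move=> A [sigma [ts _] <-]; exists m => //; exists sigma.
- by rewrite bigcup_image.
Qed.

End Growth.

(* l.+1 = n says that A is an (n-1)-simplex; for n = 0 there is none. *)
Theorem theorem1 (R : realType) (n : nat) (M : topologicalType)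
    (X : smooth_manifold R n M) (T : smooth_triangulation X) :
  [set: M] !=set0 -> connected [set: M] -> compact [set: M] ->
  exists C K : set M,
    [/\ [set: M] = C `|` K,
        C `&` K = set0,
        is_cell R n C &
        exists S : set (set M),
          [/\ finite_set S,
              (forall A, S A -> exists2 l : nat,
                 l.+1 = n & closed_simplexes T l A) &
              K = \bigcup_(A in S) A]].
Proof.
(* for n = 0 a vertex is both open and closed, hence the whole of M *)
case: n X T => [|m] X T M0 conM _; last exact: cell_decomposition.
have [p _] := M0; have [phi t r] := top_simplexes_cover T p.
have or : open_simplex phi = range phi.
  apply/seteqP; split=> q; first exact: open_simplex_range.
  move=> rq; have [//|[l' [phi' []]]] := range_stratum t rq.
  by rewrite ltn0.
have oT : open_simplex phi = setT.
  apply: conM.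
  - by exists p; rewrite or.
  - by exists (open_simplex phi); [exact: tri_top_open t | rewrite setTI].
  - by exists (open_simplex phi); [rewrite or; exact: tri_range_closed t | rewrite setTI].
exists setT, set0; split; rewrite ?setU0 ?setI0 //.
  split; first exact: openT.
  by rewrite -oT; exact: open_simplex_homeomorphic t.
by exists set0; split => //; rewrite bigcup_set0.
Qed.
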